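(* Let $\kappa,H:\mathbb{T}\to\mathbb{R}$ be bounded functions that are also bounded away from zero, with $H$ positive, and let $B_W$ be a $W$-Brownian motion. Then the equation $$\kappa^2u-D_V^+(HD_W^-u)=\dot B_W$$ has a unique weak solution with, almost surely, càdlàg sample paths. That is, almost surely there is a unique $u\in H_{W,V,\mathcal{D}}(\mathbb{T})$ such that $$\int_{\mathbb{T}}\kappa^2u g\,dV+\int_{\mathbb{T}}H\,D_W^-u\,D_W^-g\,dW=\dot B_W(g)\qquad\text{for every }g\in H_{W,V,\mathcal{D}}(\mathbb{T}),$$ and $u$ is càdlàg.
   Context: Setting. $\mathbb{T}=\mathbb{R}/\mathbb{Z}$, identified with $[0,1)$ with tagged point $0$. Càdlàg = right-continuous with left limits; càglàd = left-continuous with right limits. $W,V:\mathbb{R}\to\mathbb{R}$ are strictly increasing, $W$ càdlàg, $V$ càglàd, with $W(x+1)-W(x)=W(1)-W(0)$ and $V(x+1)-V(x)=V(1)-V(0)$ for all $x$; both are continuous at $0$ and $W(0)=V(0)=0$. They induce finite Borel measures on $\mathbb{T}$ with $dW((a,b])=W(b)-W(a)$, $dV([a,b))=V(b)-V(a)$ (atoms allowed). $L^2_V,L^2_W$ are the corresponding $L^2$ spaces with norms $\|\cdot\|_V,\|\cdot\|_W$. $H_{W,V}(\mathbb{T})$ is the Hilbert space of $f\in L^2_V(\mathbb{T})$ such that $f(x)=c+\int_{(0,x]}F\,dW$ for $V$-a.e. $x$, for some $c\in\mathbb{R}$ and $F\in L^2_W(\mathbb{T})$ with $\int_{\mathbb{T}}F\,dW=0$;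 one writes $D_W^-f=F$, identifies $f$ with the càdlàg representative $c+\int_{(0,\cdot]}F\,dW$ (so $f(0)=c$), and uses the norm $\|f\|_{W,V}^2=\|f\|_V^2+\|D_W^-f\|_W^2$. $H_{W,V,\mathcal{D}}(\mathbb{T})=\{f\in H_{W,V}(\mathbb{T}):f(0)=0\}$. A $W$-Brownian motion is a process $(B_W(t))_{t\in[0,1)}$ with $B_W(0)=0$ a.s., $B_W(t)-B_W(s)$ independent of $\sigma(B_W(u);u\le s)$ and $N(0,W(t)-W(s))$-distributed for $t>s$, and càdlàg sample paths. The pathwise $W$-Gaussian white noise is the functional on $H_{W,V,\mathcal{D}}(\mathbb{T})$ given by $\dot B_W(g)=-\int_{\mathbb{T}}B_W(s-)\,D_W^-g(s)\,dW(s)$ (which equals the stochastic integral $\int_{\mathbb{T}}g\,dB_W$). Functions $\kappa,H$ are measurable; ''bounded away from zero'' means bounded below by a positive constant. *)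

(* Defs.v *)
From HB Require Import structures.
From mathcomp Require Import all_boot all_order all_algebra.
From mathcomp Require Import all_classical all_reals all_analysis.
From mathcomp Require Import measurable_realfun.

Set Implicit Arguments.
Unset Strict Implicit.
Unset Printing Implicit Defensive.

Import Order.TTheory GRing.Theory Num.Theory.
Import numFieldTopology.Exports numFieldNormedType.Exports.

Local Open Scope classical_set_scope.
Local Open Scope ring_scope.

(* The circle R/Z is represented by its fundamental domain [0,1).  A function
   on the circle is a function R -> R of which only the values on [0,1) matter,
   and all integrals are taken over [0,1). *)
Definition circle (R : realType) : set R := `[0, 1[%classic.
Arguments circle {R}.

Definition right_continuous_on (R : realType) (A : set R) (f : R -> R) :=
  forall x, A x -> f @ x^'+ --> f x.

Definition left_continuous_on (R : realType) (A : set R) (f : R -> R) :=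
  forall x, A x -> f @ x^'- --> f x.

Definition right_limits_on (R : realType) (A : set R) (f : R -> R) :=
  forall x, A x -> cvg (f @ x^'+).

Definition left_limits_on (R : realType) (A : set R) (f : R -> R) :=
  forall x, A x -> cvg (f @ x^'-).

Record cadlag_driver (R : realType) := CadlagDriver {
  Wfun :> R -> R ;
  W_increasing : {homo Wfun : x y / x < y} ;
  W_right_continuous : right_continuous_on setT Wfun ;
  W_left_limits : left_limits_on setT Wfun ;
  W_periodic : forall x, Wfun (x + 1) - Wfun x = Wfun 1 - Wfun 0 ;
  W_continuous0 : {for 0, continuous Wfun} ;
  W0 : Wfun 0 = 0 }.

Record caglad_driver (R : realType) := CagladDriver {
  Vfun :> R -> R ;
  V_increasing : {homo Vfun : x y / x < y} ;
  V_left_continuous : left_continuous_on setT Vfun ;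
  V_right_limits : right_limits_on setT Vfun ;
  V_periodic : forall x, Vfun (x + 1) - Vfun x = Vfun 1 - Vfun 0 ;
  V_continuous0 : {for 0, continuous Vfun} ;
  V0 : Vfun 0 = 0 }.

Section measure_W.
Context {R : realType} (W : cadlag_driver R).

Definition Wcumul : R -> R := W.

Let Wcumul_nd : nondecreasing Wcumul.
Proof. by apply: (@ltW_homo _ _ R R); exact: W_increasing. Qed.

Let Wcumul_rc x : Wcumul @ x^'+ --> Wcumul x.
Proof. exact: W_right_continuous. Qed.

HB.instance Definition _ := isCumulative.Build R _ R Wcumul Wcumul_nd Wcumul_rc.

(* This measure lives on R; its restriction to [0,1) is the measure dW. *)
Definition dW : {measure set (measurableTypeR R) -> \bar R} :=
  lebesgue_stieltjes_measure Wcumul.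

Lemma dW_itv (a b : R) : a <= b -> dW `]a, b]%classic = (W b - W a)%:E.
Proof.
move=> ab; rewrite /dW /= /lebesgue_stieltjes_measure/= /measure_extension/=.
rewrite measurable_mu_extE/=; last exact: is_ocitv.
by rewrite wlength_itv_bnd.
Qed.

End measure_W.

(* The library's Stieltjes measures are built from right-continuous functions.
   As V is left-continuous, x |-> - V (- x) is right-continuous, and dV is the
   image under x |-> - x of its Stieltjes measure (see dV_itv). *)
Section measure_V.
Context {R : realType} (V : caglad_driver R).

Definition Vreflect (x : R) : R := - V (- x).

Let Vreflect_nd : nondecreasing Vreflect.
Proof.
move=> x y xy; rewrite /Vreflect lerN2.
by apply: (@ltW_homo _ _ R R); [exact: V_increasing|rewrite lerN2].
Qed.

Let Vreflect_rc x : Vreflect @ x^'+ --> Vreflect x.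
Proof.
apply: cvgN; have := @V_left_continuous _ V (- x) I.
by rewrite at_leftN.
Qed.

HB.instance Definition _ :=
  isCumulative.Build R _ R Vreflect Vreflect_nd Vreflect_rc.

Let oppR : measurableTypeR R -> measurableTypeR R := -%R.

Let measurable_oppR : measurable_fun [set: measurableTypeR R] oppR.
Proof. exact: oppr_measurable. Qed.

Definition dV : {measure set (measurableTypeR R) -> \bar R} :=
  measure_function_pushforward__canonical__measure_function_Measure
    (lebesgue_stieltjes_measure Vreflect) measurable_oppR.

Lemma dVE (A : set R) :
  dV A = lebesgue_stieltjes_measure Vreflect [set x | A (- x)].
Proof. by []. Qed.

Lemma dV_itv (a b : R) : a <= b -> dV `[a, b[%classic = (V b - V a)%:E.
Proof.
move=> ab; rewrite dVE.
have -> : [set x | `[a, b[%classic (- x)] = `]- b, - a]%classic.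
  by apply/seteqP; split=> x /=; rewrite !in_itv/= lerNr ltrNl andbC.
rewrite /lebesgue_stieltjes_measure/= /measure_extension/=.
rewrite measurable_mu_extE/=; last exact: is_ocitv.
by rewrite wlength_itv_bnd ?lerN2// /Vreflect !opprK addrC.
Qed.

End measure_V.

Section function_spaces.
Context {R : realType} (W : cadlag_driver R) (V : caglad_driver R).
Implicit Types (f F g : R -> R).

Definition L2_V f := (f \_ circle) \in Lfun (dV V) 2%:E.

Definition L2_W F := (F \_ circle) \in Lfun (dW W) 2%:E.

(* The càdlàg function c + \int_(0, x] F dW. *)
Definition primitive (p : R * (R -> R)) (x : R) : R :=
  p.1 + \int[dW W]_(y in `]0, x]) p.2 y.

(* p = (c, F) represents f when F is in L^2_W with zero mean and
   f x = c + \int_(0, x] F dW for V-almost every x. *)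
Definition represents f (p : R * (R -> R)) : Prop :=
  [/\ L2_W p.2, \int[dW W]_(y in circle) p.2 y = 0 &
      f = primitive p %[ae dV V in circle] ].

Definition HWV : set (R -> R) :=
  [set f | L2_V f /\ exists p, represents f p].

(* For f in HWV, c is determined by f and F is determined up to dW-null sets;
   one such pair is chosen. *)
Definition repr_pair f : R * (R -> R) := xget (0, cst 0) [set p | represents f p].

Definition DW f : R -> R := (repr_pair f).2.

Definition cadlag_repr f : R -> R := primitive (repr_pair f).

Definition HWVD : set (R -> R) := [set f | HWV f /\ cadlag_repr f 0 = 0].

End function_spaces.

(* Left limits at 0 are taken, through periodicity, at 1. *)
Definition cadlag_circle (R : realType) (f : R -> R) : Prop :=
  right_continuous_on `[0, 1[ f /\ left_limits_on `]0, 1] f.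

Definition bounded_away_from_zero (R : realType) (f : R -> R) : Prop :=
  exists2 c, 0 < c & forall x, circle x -> c <= `|f x|.

Section brownian_motion.
Context {R : realType} (W : cadlag_driver R).
Context d (Omega : measurableType d) (P : probability Omega R).

(* The process is indexed by [0,1): only the values B t with t in [0,1) are
   constrained or used. *)
Implicit Types (B : R -> {RV P >-> R}).

(* The sigma-algebra generated by B u for 0 <= u <= s. *)
Definition past B (s : R) : set (set Omega) :=
  <<s \bigcup_(u in `[0, s]) preimage_set_system setT (B u) measurable >>.

Definition increment B (s t : R) (omega : Omega) : R := B t omega - B s omega.

Record is_W_brownian_motion B : Prop := {
  brownian0 : {ae P, forall omega, B 0 omega = 0} ;
  brownian_independent : forall s t, 0 <= s -> s < t -> t < 1 ->
    forall (A : set R) (E : set Omega), measurable A -> past B s E ->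
      P (increment B s t @^-1` A `&` E) = (P (increment B s t @^-1` A) * P E)%E ;
  (* the second parameter of normal_prob is the standard deviation *)
  brownian_normal : forall s t, 0 <= s -> s < t -> t < 1 ->
    forall A : set R, measurable A ->
      P (increment B s t @^-1` A) = normal_prob 0 (Num.sqrt (W t - W s)) A ;
  brownian_cadlag : forall omega,
    right_continuous_on `[0, 1[ (fun t => B t omega) /\
    left_limits_on `]0, 1[ (fun t => B t omega) }.

End brownian_motion.

Section weak_solutions.
Context {R : realType} (W : cadlag_driver R) (V : caglad_driver R).

(* The pathwise white noise of a path b, evaluated at g.  The value of the left
   limit at s = 0 is immaterial, because {0} is a dW-null set. *)
Definition white_noise (b : R -> R) (g : R -> R) : R :=
  - \int[dW W]_(s in circle) (lim (b @ s^'-) * DW W V g s).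

Definition weak_solution (kappa H b u : R -> R) : Prop :=
  HWVD W V u /\
  forall g, HWVD W V g ->
    \int[dV V]_(x in circle) (kappa x ^+ 2 * u x * g x) +
    \int[dW W]_(x in circle) (H x * DW W V u x * DW W V g x)
    = white_noise b g.

End weak_solutions.

(* Main.v *)
Require Import Defs.
From HB Require Import structures.
From mathcomp Require Import all_boot all_order all_algebra.
From mathcomp Require Import all_classical all_reals all_analysis.
From mathcomp Require Import measurable_realfun.
From mathcomp Require Import ring lra.

Set Implicit Arguments.
Unset Strict Implicit.
Unset Printing Implicit Defensive.

Import Order.TTheory GRing.Theory Num.Theory.
Import numFieldTopology.Exports numFieldNormedType.Exports.

Local Open Scope classical_set_scope.
Local Open Scope ring_scope.

(* The equation is solved as a two-point boundary value problem by shooting.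
   Put h = 1/H, k = kappa^2 and let beta be the path of left limits of the
   Brownian path.  Integrating the equation once gives
     D_W u = F := h (c - beta + \int_[0,y) k u dV)
   for a constant c, and u(x) = \int_(0,x] F dW is then a Volterra equation.
   Its Picard iterates converge because the inner variable z and the outer one
   y satisfy z < y <= x, so the n-th increment is at most C^n times the dV-mass
   of the chains z_1 < ... < z_n, that is C^n V(1)^n / n!.  The solution is
   affine in c and, the kernel being nonnegative, the coefficient of c in
   \int F dW is at least \int h dW > 0: some c makes \int F dW vanish.  Fubini's
   theorem turns the integrated equation into the weak form.  Testing the
   difference of two solutions against itself gives uniqueness.  The only
   probabilistic input is that beta lies in L^2(dW) almost surely; it follows
   from E[B(t)^2] <= C W(1) and Fatou's lemma. *)

(** * Bounded functions and Fubini for finite measures *)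

(** Both measures may have atoms, so the strictness of inequalities matters. Fubini's theorem turns
    [y <= x], the range of the càdlàg primitive against dW, into the complement of [x < y], which is
    why the inner integral against dV runs over a strict half-line. Strict chains consist of
    distinct points, their n! orderings are disjoint, and coincidences at atoms only make the mass
    of the chains smaller: the factorial bound survives. The constant c appears because test
    functions have derivatives of zero mean, so the integrated equation is fixed only up to a
    constant; the periodicity condition \int F dW = 0 on the solution determines it. The noise
    enters the Volterra equation only through the primitive of h beta, which is bounded as soon as
    beta is integrable, so the iteration stays among bounded functions. Left limits of the Brownian
    path are prescribed only inside (0,1): boundedness up to 1 cannot be read off from the
    regularity of the path, hence the moment estimate. As u is a primitive at every point and not
    only almost everywhere, it is itself càdlàg. *)

Section dominated_fubini.
Context d1 d2 (T1 : measurableType d1) (T2 : measurableType d2) (R : realType).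
Variable m1 : {finite_measure set T1 -> \bar R}.
Variable m2 : {finite_measure set T2 -> \bar R}.
Variables (f : T1 * T2 -> R) (a : T1 -> R) (b : T2 -> R).
Hypothesis mf : measurable_fun setT f.
Hypothesis ia : m1.-integrable setT (EFin \o a).
Hypothesis ib : m2.-integrable setT (EFin \o b).
Hypothesis fab : forall x y, `|f (x, y)| <= `|a x| * `|b y|.

Lemma dominated_integrable_section1 x :
  m2.-integrable setT (EFin \o (fun y => f (x, y))).
Proof.
apply: (@le_integrable _ _ _ m2 setT measurableT _ (fun y => `|a x|%:E * (`|b y|)%:E)%E).
- apply/measurable_EFinP; exact: measurableT_comp mf (measurable_pair1 x).
- by move=> y _ /=; rewrite lee_fin normrM !normr_id.
- apply: integrableZl => //; exact: integrable_norm ib.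
Qed.

Lemma dominated_integrable_section2 y :
  m1.-integrable setT (EFin \o (fun x => f (x, y))).
Proof.
apply: (@le_integrable _ _ _ m1 setT measurableT _ (fun x => `|b y|%:E * (`|a x|)%:E)%E).
- apply/measurable_EFinP; exact: measurableT_comp mf (measurable_pair2 y).
- by move=> x _ /=; rewrite lee_fin normrM !normr_id mulrC.
- apply: integrableZl => //; exact: integrable_norm ia.
Qed.

Lemma dominated_integrable_prod : (m1 \x m2)%E.-integrable setT (EFin \o f).
Proof.
apply/integrable12ltyP; first exact/measurable_EFinP.
have iA : m1.-integrable setT (fun x => `|a x|%:E * (\int[m2]_y (`|b y|)%:E))%E.
  rewrite -(fineK (integrable_fin_num measurableT (integrable_norm ib))).
  exact: (integrableZr measurableT _ (integrable_norm ia)).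
apply: le_lt_trans (integrable_lty measurableT iA).
apply: ge0_le_integral => //.
- by move=> x _; apply: integral_ge0.
- apply: (measurable_fun_fubini_tonelli_F (m2 := m2) (fun p => `|(EFin \o f) p|%E)) => //.
  by apply: measurableT_comp => //; exact/measurable_EFinP.
- exact: measurable_int iA.
move=> x _; rewrite -ge0_integralZl //.
- apply: ge0_le_integral => //.
  + apply: measurableT_comp => //; apply/measurable_EFinP.
    exact: measurableT_comp mf (measurable_pair1 x).
  + apply: emeasurable_funM => //; apply/measurable_EFinP.
    by apply: measurableT_comp => //; move/measurable_int : ib => /measurable_EFinP.
  + by move=> y _ /=; rewrite lee_fin.
- apply/measurable_EFinP.
  by apply: measurableT_comp => //; move/measurable_int : ib => /measurable_EFinP.
Qed.

Lemma dominated_measurable1 : measurable_fun setT (fun x => \int[m2]_y f (x, y)).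
Proof.
apply: measurableT_comp => //.
exact: measurable_fubini_F dominated_integrable_prod.
Qed.

(** A real-valued integral is [fine] of the extended one, so the inner integrals must be finite
    before [fine] can be removed. The product bound makes every section integrable, not only almost
    every one. *)
Lemma dominated_Fubini :
  \int[m1]_x (\int[m2]_y f (x, y)) = \int[m2]_y (\int[m1]_x f (x, y)).
Proof.
rewrite /Rintegral; congr fine.
under eq_integral => x _.
  rewrite fineK; last first.
    apply: integrable_fin_num => //; exact: dominated_integrable_section1.
  over.
under [RHS]eq_integral => y _.
  rewrite fineK; last first.
    apply: integrable_fin_num => //; exact: dominated_integrable_section2.
  over.
exact: (Fubini (f := EFin \o f) dominated_integrable_prod).
Qed.

End dominated_fubini.

Section bounded_measurable.
Context d (T : measurableType d) (R : realType).
Implicit Types f g : T -> R.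

(** The class in which the Picard iteration lives: the bound holds everywhere, so the class is
    stable under products and integrable for any finite measure. *)
Definition bmeas f := measurable_fun setT f /\ exists M : R, forall x, `|f x| <= M.

Lemma bmeas_cst c : bmeas (cst c).
Proof. by split; [exact: measurable_cst|exists `|c|]. Qed.

Lemma bmeasD f g : bmeas f -> bmeas g -> bmeas (fun x => f x + g x).
Proof.
move=> [mf [M fM]] [mg [N gN]]; split; first exact: measurable_funD.
by exists (M + N) => x; rewrite (le_trans (ler_normD _ _))// lerD.
Qed.

Lemma bmeasM f g : bmeas f -> bmeas g -> bmeas (fun x => f x * g x).
Proof.
move=> [mf [M fM]] [mg [N gN]]; split; first exact: measurable_funM.
by exists (M * N) => x; rewrite normrM ler_pM.
Qed.

Lemma bmeas_norm f : bmeas f -> bmeas (fun x => `|f x|).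
Proof.
move=> [mf [M fM]]; split; first exact: measurableT_comp.
by exists M => x; rewrite normr_id.
Qed.

Lemma bmeas_bool (b : T -> bool) : measurable_fun setT b ->
  bmeas (fun x => (b x)%:R).
Proof.
move=> mb; split; last by exists 1 => x; case: (b x); rewrite ?normr1 ?normr0.
have -> : (fun x => (b x)%:R : R) = \1_[set x | b x].
  by apply/funext => x; rewrite indicE mem_setE.
apply: measurable_indic; rewrite -[X in measurable X]setTI.
exact: (mb measurableT [set true]).
Qed.

Variable mu : {finite_measure set T -> \bar R}.

Lemma bmeas_integrable f : bmeas f -> mu.-integrable setT (EFin \o f).
Proof.
move=> [mf [M fM]]; apply: measurable_bounded_integrable => //.
  by rewrite ltey_eq fin_num_measure.
exists M; split; first exact: num_real.
by move=> x Mx y _ /=; rewrite (le_trans (fM y))// ltW.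
Qed.

Lemma bmeasM_integrable f g : bmeas f -> mu.-integrable setT (EFin \o g) ->
  mu.-integrable setT (EFin \o (fun x => f x * g x)).
Proof.
move=> [mf [M fM]] ig; have mg := measurable_int _ ig.
apply: (@le_integrable _ _ _ mu setT measurableT _ (fun x => M%:E * (`|g x|)%:E)%E).
- by apply/measurable_EFinP/measurable_funM => //; exact/measurable_EFinP.
- move=> x _ /=; rewrite lee_fin !normrM normr_id ler_wpM2r//.
  by rewrite (le_trans (fM x))// ler_norm.
- by apply: integrableZl => //; exact: integrable_norm ig.
Qed.

End bounded_measurable.

Section running_integral.
Context d1 d2 (S : measurableType d1) (T : measurableType d2) (R : realType).
Variable nu : {finite_measure set T -> \bar R}.

Lemma bmeas_kernel (x0 : S) (f : T -> R) (e : S * T -> bool) :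
  nu.-integrable setT (EFin \o f) -> measurable_fun setT e ->
  bmeas (fun x => \int[nu]_z (f z * (e (x, z))%:R)).
Proof.
move=> intf me; have mf : measurable_fun setT f.
  exact/measurable_EFinP/(measurable_int _ intf).
have me1 x : bmeas (fun z => (e (x, z))%:R : R).
  by apply: bmeas_bool; exact: (measurableT_comp me (measurable_pair1 x)).
have ife x : nu.-integrable setT (EFin \o (fun z => f z * (e (x, z))%:R)).
  by under eq_fun do rewrite mulrC; exact: bmeasM_integrable.
split.
  (* Measurability in [x] is read off from Fubini's theorem, which asks for a finite measure on the
     first factor; the Dirac mass at [x0] provides one. *)
  pose m1 := dirac x0 : {finite_measure set S -> \bar R}.
  apply: (@dominated_measurable1 _ _ _ _ R m1 nu
     (fun p => f p.2 * (e p)%:R) (cst 1) f) => //.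
  - apply: measurable_funM; first exact: measurableT_comp.
    by have [] := @bmeas_bool _ _ R e me.
  - exact: finite_measure_integrable_cst.
  - move=> x y /=; rewrite normr1 mul1r normrM.
    by case: (e _); rewrite ?normr1 ?normr0 ?mulr1// mulr0.
exists (\int[nu]_z `|f z|) => x.
apply: (le_trans (le_normr_Rintegral _ (ife x))) => //.
apply: le_Rintegral => //; [exact: integrable_norm (ife x)|exact: integrable_norm intf|].
move=> z _; rewrite normrM.
by case: (e _); rewrite ?normr1 ?normr0 ?mulr1// mulr0.
Qed.

End running_integral.

Lemma measurable_fun_pointwise_cvg d (T : measurableType d) (R : realType)
    (f_ : nat -> T -> R) (f : T -> R) :
  (forall n, measurable_fun setT (f_ n)) ->
  (forall x, f_ n x @[n --> \oo] --> f x) -> measurable_fun setT f.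
Proof.
move=> mf cf; apply/measurable_EFinP.
apply: (emeasurable_fun_cvg (fun n => EFin \o f_ n)) => [n|x _].
  exact/measurable_EFinP.
by apply: cvg_EFin; [exact: nearW|exact: cf].
Qed.

Lemma Rdominated_convergence d (T : measurableType d) (R : realType)
    (mu : {measure set T -> \bar R}) (f_ : nat -> T -> R) (f g : T -> R) :
  (forall n, measurable_fun setT (f_ n)) -> mu.-integrable setT (EFin \o g) ->
  (forall x, f_ n x @[n --> \oo] --> f x) ->
  (forall n x, `|f_ n x| <= g x) ->
  \int[mu]_x f_ n x @[n --> \oo] --> \int[mu]_x f x.
Proof.
move=> mf ig cf fg.
have cEf x : EFin (f_ n x) @[n --> \oo] --> (f x)%:E.
  by apply: cvg_EFin; [exact: nearW|exact: cf].
have mf0 : measurable_fun setT f by exact: measurable_fun_pointwise_cvg cf.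
have [intf _ cI] := @dominated_convergence _ _ _ mu setT measurableT
  (fun n => EFin \o f_ n) (EFin \o f) (EFin \o g)
  (fun n => (measurable_EFinP _ _).2 (mf n)) ((measurable_EFinP _ _).2 mf0)
  (aeW _ (fun x _ => cEf x))
  ig (aeW _ (fun x n _ => fg n x)).
apply: fine_cvg; rewrite fineK//; exact: integrable_fin_num.
Qed.

(** * The Volterra equation *)

Section half_lines.
Context (R : realType).
Local Notation T := (measurableTypeR R).
Variable nu : {finite_measure set T -> \bar R}.
Implicit Types f : R -> R.

(** The half-line enters as an indicator factor so that [x] is a parameter of the integrand, as in
    [bmeas_kernel]. [below] is the left-continuous primitive, suited to dV, and [upto] the
    right-continuous one, suited to dW. *)
Definition below f (x : R) : R := \int[nu]_z (f z * (z < x)%R%:R).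

Definition upto f (x : R) : R := \int[nu]_z (f z * (z <= x)%R%:R).

Lemma measurable_lt2 : measurable_fun setT (fun p : T * T => p.2 < p.1).
Proof. exact: measurable_fun_ltr. Qed.

Lemma measurable_le2 : measurable_fun setT (fun p : T * T => p.2 <= p.1).
Proof. exact: measurable_fun_ler. Qed.

Lemma bmeas_lt (x : R) : @bmeas _ T R (fun z => (z < x)%R%:R).
Proof. by apply: bmeas_bool; exact: measurable_fun_ltr. Qed.

Lemma bmeas_gt (x : R) : @bmeas _ T R (fun z => (x < z)%R%:R).
Proof. by apply: bmeas_bool; exact: measurable_fun_ltr. Qed.

Lemma bmeas_le (x : R) : @bmeas _ T R (fun z => (z <= x)%R%:R).
Proof. by apply: bmeas_bool; exact: measurable_fun_ler. Qed.

Lemma integrable_lt f x : nu.-integrable setT (EFin \o f) ->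
  nu.-integrable setT (EFin \o (fun z => f z * (z < x)%R%:R)).
Proof.
by under eq_fun do rewrite mulrC; apply: bmeasM_integrable; exact: bmeas_lt.
Qed.

Lemma integrable_le f x : nu.-integrable setT (EFin \o f) ->
  nu.-integrable setT (EFin \o (fun z => f z * (z <= x)%R%:R)).
Proof.
by under eq_fun do rewrite mulrC; apply: bmeasM_integrable; exact: bmeas_le.
Qed.

Lemma bmeas_below f : nu.-integrable setT (EFin \o f) -> @bmeas _ T R (below f).
Proof. by move=> intf; exact: (bmeas_kernel (0 : T) intf measurable_lt2). Qed.

Lemma bmeas_upto f : nu.-integrable setT (EFin \o f) -> @bmeas _ T R (upto f).
Proof. by move=> intf; exact: (bmeas_kernel (0 : T) intf measurable_le2). Qed.

Lemma below_ge0 f x : (forall z, 0 <= f z) -> 0 <= below f x.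
Proof. by move=> f0; apply: Rintegral_ge0 => z _; rewrite mulr_ge0. Qed.

Lemma le_below f g x : nu.-integrable setT (EFin \o f) ->
  nu.-integrable setT (EFin \o g) -> (forall z, f z <= g z) ->
  below f x <= below g x.
Proof.
move=> If Ig fg; apply: le_Rintegral; rewrite //; [exact: integrable_lt..|].
by move=> z _; rewrite ler_wpM2r.
Qed.

(* The mass of the ordered chains z_1 < ... < z_n < x. *)
Fixpoint chain (n : nat) : R -> R :=
  if n is m.+1 then below (chain m) else cst 1.

Lemma bmeas_chain n : @bmeas _ T R (chain n).
Proof.
elim: n => [|n IH] /=; first exact: bmeas_cst.
by apply: bmeas_below; exact: bmeas_integrable.
Qed.

Lemma chain_ge0 n x : 0 <= chain n x.
Proof. by elim: n x => [|n IH] x //=; apply: below_ge0. Qed.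

Let mass : R := fine (nu setT).

(* Integration by parts: two points below x, the second of which carries a
   chain of length n, are ordered in one of the two ways or coincide. *)
Lemma below_parts n x :
  below (fun z => chain 1 z * chain n z) x + chain n.+2 x <= chain 1 x * chain n.+1 x.
Proof.
have bc := bmeas_chain.
have ic m : nu.-integrable setT (EFin \o chain m) by exact: bmeas_integrable.
have blt1 (p : R -> R) : @bmeas _ T R p ->
    @bmeas _ T R (fun z => p z * (z < x)%R%:R).
  by move=> bp; apply: bmeasM => //; exact: bmeas_lt.
(* The order of integration is exchanged so that, in all three terms, the outer variable [z] carries
   the chain of length [n] and the comparison can be made pointwise in [z] and [w]. *)
have -> : chain n.+2 x =
    \int[nu]_z \int[nu]_w (chain n z * (z < x)%R%:R * ((z < w)%R%:R * (w < x)%R%:R)).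
  rewrite (dominated_Fubini (m1 := nu) (m2 := nu)
    (f := fun p => chain n p.1 * (p.1 < x)%R%:R * ((p.1 < p.2)%R%:R * (p.2 < x)%R%:R))
    (a := chain n) (b := cst 1)); first last.
  - move=> z w /=; rewrite normr1 mulr1 !normrM.
    by do 3![case: (_ < _); rewrite ?normr1 ?normr0 ?mulr1 ?mulr0].
  - exact: finite_measure_integrable_cst.
  - exact: ic.
  - apply: measurable_funM.
      exact: (measurableT_comp (proj1 (blt1 _ (bc n))) measurable_fst).
    apply: measurable_funM.
      have mlt : measurable_fun setT (fun p : T * T => p.1 < p.2) by exact: measurable_fun_ltr.
      by have [] := @bmeas_bool _ _ R _ mlt.
    exact: (measurableT_comp (proj1 (bmeas_lt x)) measurable_snd).
  apply: eq_Rintegral => w _ /=; rewrite /below -RintegralZr//; last exact: integrable_lt.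
  apply: eq_Rintegral => z _ /=.
  case: (ltP w x) => wx; last by rewrite !mulr0.
  case: (ltP z w) => zw; last by rewrite mul0r !mulr0 mul0r.
  by rewrite (lt_trans zw wx) !mulr1.
have -> : below (fun z => chain 1 z * chain n z) x =
    \int[nu]_z \int[nu]_w (chain n z * (z < x)%R%:R * ((w < z)%R%:R)).
  apply: eq_Rintegral => z _; rewrite RintegralZl//; last first.
    by apply: bmeas_integrable; exact: bmeas_lt.
  rewrite mulrAC mulrC -mulrA; congr (_ * _); rewrite mulrC; congr (_ * _).
  by rewrite /= /below; under eq_Rintegral do rewrite mul1r.
have -> : chain 1 x * chain n.+1 x =
    \int[nu]_z \int[nu]_w (chain n z * (z < x)%R%:R * ((w < x)%R%:R)).
  rewrite [X in _ * X]/= /below -RintegralZl//; last exact: integrable_lt.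
  apply: eq_Rintegral => z _; rewrite RintegralZl//; last first.
    by apply: bmeas_integrable; exact: bmeas_lt.
  rewrite mulrC; congr (_ * _).
  by rewrite /= /below; under eq_Rintegral do rewrite mul1r.
have bw (z : R) (g : R -> R) : @bmeas _ T R g ->
    nu.-integrable setT (EFin \o (fun w => chain n z * (z < x)%R%:R * g w)).
  move=> bg; apply: bmeas_integrable; apply: bmeasM => //; exact: bmeas_cst.
have bz (g : T * T -> bool) : measurable_fun setT g ->
    nu.-integrable setT (EFin \o (fun z =>
      \int[nu]_w (chain n z * (z < x)%R%:R * ((g (z, w))%:R)))).
  move=> mg; have b1 z : @bmeas _ T R (fun w => (g (z, w))%:R).
    by apply: bmeas_bool; exact: measurableT_comp mg (measurable_pair1 z).
  have -> : (fun z => \int[nu]_w (chain n z * (z < x)%R%:R * (g (z, w))%:R)) =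
      (fun z => chain n z * (z < x)%R%:R * \int[nu]_w (cst 1 w * (g (z, w))%:R)).
    apply/funext => z; rewrite RintegralZl//; last exact: bmeas_integrable.
    by under [in RHS]eq_Rintegral do rewrite mul1r.
  apply: bmeas_integrable; apply: bmeasM; first exact: blt1.
  apply: (bmeas_kernel (0 : T) _ mg).
  exact: finite_measure_integrable_cst.
have mlt3 : measurable_fun setT (fun p : T * T => (p.1 < p.2) && (p.2 < x)).
  by apply: measurable_and; exact: measurable_fun_ltr.
rewrite -RintegralD//; last 2 first.
- by apply: (bz (fun p => p.2 < p.1)); exact: measurable_lt2.
- apply: eq_integrable (bz _ mlt3) => // z _ /=.
  by congr EFin; apply: eq_Rintegral => w _ /=; rewrite -mulnb natrM.
apply: le_Rintegral => //.
- have := integrableD measurableT (bz _ measurable_lt2) (bz _ mlt3).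
  apply: eq_integrable => // z _; rewrite /= EFinD; congr (_ + _)%E.
  by congr EFin; apply: eq_Rintegral => w _ /=; rewrite -mulnb natrM.
- by apply: (bz (fun p => p.2 < x)); exact: measurable_fun_ltr.
move=> z _; rewrite -RintegralD//; last 2 first.
- by apply: bw; exact: bmeas_lt.
- by apply: bw; apply: bmeasM; [exact: bmeas_gt|exact: bmeas_lt].
apply: le_Rintegral => //.
- under eq_fun do rewrite -mulrDr.
  apply: bw; apply: bmeasD; first exact: bmeas_lt.
  by apply: bmeasM; [exact: bmeas_gt|exact: bmeas_lt].
- by apply: bw; exact: bmeas_lt.
(* For [z < x] the indicators of [w < z] and of [z < w < x] add up to at most that of [w < x].
   Equality holds off the diagonal [w = z], whose mass, due to atoms, is what is lost. *)
move=> w _; rewrite -mulrDr; case: (ltP z x) => zx; last by rewrite !mulr0 !mul0r.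
rewrite mulr1 ler_wpM2l ?chain_ge0//.
case: (ltP w z) => wz; first by rewrite (lt_gtF wz) (lt_trans wz zx) mul0r addr0.
by rewrite add0r; case: (ltP z w); case: (ltP w x); rewrite ?mul0r ?mulr0 ?mulr1.
Qed.

End half_lines.

Section half_lines_theory.
Context (R : realType).
Local Notation T := (measurableTypeR R).
Variable nu : {finite_measure set T -> \bar R}.
Implicit Types f : R -> R.

Lemma integrable_lin f g a : nu.-integrable setT (EFin \o f) ->
  nu.-integrable setT (EFin \o g) ->
  nu.-integrable setT (EFin \o (fun z => f z + a * g z)).
Proof.
move=> If Ig; have := integrableD measurableT If (integrableZl measurableT a Ig).
by apply: eq_integrable.
Qed.

Lemma below_lin f g a x : nu.-integrable setT (EFin \o f) ->
  nu.-integrable setT (EFin \o g) ->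
  below nu (fun z => f z + a * g z) x = below nu f x + a * below nu g x.
Proof.
move=> If Ig; have If' := integrable_lt x If; have Ig' := integrable_lt x Ig.
rewrite /below -RintegralZl// -RintegralD//; last first.
  by have := integrableZl measurableT a Ig'; apply: eq_integrable.
by apply: eq_Rintegral => z _; rewrite mulrDl mulrA.
Qed.

Lemma upto_lin f g a x : nu.-integrable setT (EFin \o f) ->
  nu.-integrable setT (EFin \o g) ->
  upto nu (fun z => f z + a * g z) x = upto nu f x + a * upto nu g x.
Proof.
move=> If Ig; have If' := integrable_le x If; have Ig' := integrable_le x Ig.
rewrite /upto -RintegralZl// -RintegralD//; last first.
  by have := integrableZl measurableT a Ig'; apply: eq_integrable.
by apply: eq_Rintegral => z _; rewrite mulrDl mulrA.
Qed.

(** A chain of n + 1 points splits in n + 1 ways into one of its points and a chain of n. In the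
    induction, [below_parts] accounts for one copy and the integrated induction hypothesis for the
    others. *)
Lemma chain_step n x : n.+1%:R * chain nu n.+1 x <= chain nu 1 x * chain nu n x.
Proof.
have ic m : nu.-integrable setT (EFin \o chain nu m).
  by apply: bmeas_integrable; exact: bmeas_chain.
elim: n x => [|n IH] x; first by rewrite mul1r mulr1.
apply: le_trans (below_parts nu n x).
rewrite -natr1 mulrDl mul1r lerD2r [X in _ * X]/=.
have -> : n.+1%:R * below nu (chain nu n.+1) x =
    below nu (fun z => n.+1%:R * chain nu n.+1 z) x.
  rewrite /below -RintegralZl//; last exact: integrable_lt.
  by apply: eq_Rintegral => z _; rewrite mulrA.
apply: le_below => //.
  by have := integrableZl measurableT n.+1%:R (ic n.+1); apply: eq_integrable.
by apply: bmeas_integrable; apply: bmeasM; exact: bmeas_chain.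
Qed.

Lemma chain_le n x : chain nu n x <= fine (nu setT) ^+ n / n`!%:R.
Proof.
have c1 : chain nu 1 x <= fine (nu setT).
  rewrite -[leRHS]mul1r -Rintegral_cst//.
  apply: le_Rintegral => //.
  - apply: integrable_lt; exact: finite_measure_integrable_cst.
  - exact: finite_measure_integrable_cst.
  - by move=> z _ /=; rewrite mul1r; case: (_ < _).
elim: n => [|n IH]; first by rewrite expr0 fact0 divr1.
have n0 : 0 < n.+1%:R :> R by rewrite ltr0n.
rewrite -(ler_pM2l n0); apply: (le_trans (chain_step n x)).
rewrite factS natrM invfM mulrCA mulVKf ?gt_eqF// exprS -mulrA.
by apply: ler_pM => //; exact: chain_ge0.
Qed.

End half_lines_theory.

Section volterra.
Context (R : realType).
Local Notation T := (measurableTypeR R).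
Variables (mu nu : {finite_measure set T -> \bar R}) (h k : R -> R).
Hypotheses (bh : @bmeas _ T R h) (bk : @bmeas _ T R k).
Hypotheses (h0 : forall x, 0 <= h x) (k0 : forall x, 0 <= k x).
Implicit Types u v : R -> R.

Definition flux u : R -> R := below nu (fun z => k z * u z).

Definition volterra u : R -> R := upto mu (fun y => h y * flux u y).

Lemma bmeas_flux u : @bmeas _ T R u -> @bmeas _ T R (flux u).
Proof.
by move=> bu; apply: bmeas_below; apply: bmeas_integrable; exact: bmeasM.
Qed.

Lemma bmeas_volterra u : @bmeas _ T R u -> @bmeas _ T R (volterra u).
Proof.
move=> bu; apply: bmeas_upto; apply: bmeas_integrable; apply: bmeasM => //.
exact: bmeas_flux.
Qed.

Lemma flux_lin u v a x : @bmeas _ T R u -> @bmeas _ T R v ->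
  flux (fun z => u z + a * v z) x = flux u x + a * flux v x.
Proof.
move=> bu bv; rewrite -below_lin.
- by congr below; apply/funext => z; rewrite mulrDr mulrCA.
- by apply: bmeas_integrable; exact: bmeasM.
- by apply: bmeas_integrable; exact: bmeasM.
Qed.

Lemma volterra_lin u v a x : @bmeas _ T R u -> @bmeas _ T R v ->
  volterra (fun z => u z + a * v z) x = volterra u x + a * volterra v x.
Proof.
move=> bu bv; rewrite -upto_lin.
- congr upto; apply/funext => z.
  by rewrite flux_lin// mulrDr mulrCA.
- by apply: bmeas_integrable; apply: bmeasM => //; exact: bmeas_flux.
- by apply: bmeas_integrable; apply: bmeasM => //; exact: bmeas_flux.
Qed.

Lemma volterra_ge0 u x : (forall z, 0 <= u z) -> 0 <= volterra u x.
Proof.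
move=> u0; apply: Rintegral_ge0 => y _; rewrite !mulr_ge0//.
by apply: below_ge0 => z; rewrite mulr_ge0.
Qed.

(* In the double integral z < y <= x, so the inner variable stays below x. *)
Lemma volterra_bound : exists2 c : R, 0 <= c & forall u x, @bmeas _ T R u ->
  `|volterra u x| <= c * below nu (fun z => `|u z|) x.
Proof.
have [_ [hM hhM]] := bh; have [_ [kM kkM]] := bk.
have hM0 : 0 <= hM by exact: le_trans (hhM 0).
have kM0 : 0 <= kM by exact: le_trans (kkM 0).
(* The outer integral is estimated crudely, by the bounds of [h] and [k] and the total mass of [mu];
   only the [nu]-integral keeps its dependence on [x], since it alone is iterated into chains. *)
exists (hM * kM * fine (mu setT)); first by rewrite !mulr_ge0 ?fine_ge0.
move=> u x bu; pose C := below nu (fun z => `|u z|) x.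
have bkx y : @bmeas _ T R (fun z => k z * u z * (z < y)%R%:R).
  by apply: bmeasM; [exact: bmeasM|exact: bmeas_lt].
have fluxle y : y <= x -> `|flux u y| <= kM * C.
  move=> yx; apply: (le_trans (le_normr_Rintegral _ (bmeas_integrable nu (bkx y)))) => //.
  rewrite /C /below -RintegralZl//; last first.
    by apply: integrable_lt; apply: bmeas_integrable; exact: bmeas_norm.
  apply: le_Rintegral => //.
  - by apply: bmeas_integrable; exact: bmeas_norm.
  - apply: bmeas_integrable; apply: bmeasM; first exact: bmeas_cst.
    by apply: bmeasM; [exact: bmeas_norm|exact: bmeas_lt].
  move=> z _; rewrite !normrM -mulrA; apply: ler_pM => //.
  rewrite ler_wpM2l//; case: (ltP z y) => zy; last by rewrite normr0.
  by rewrite (lt_le_trans zy yx) normr1.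
have bhf : @bmeas _ T R (fun y => h y * flux u y * (y <= x)%R%:R).
  by apply: bmeasM; [apply: bmeasM => //; exact: bmeas_flux|exact: bmeas_le].
apply: (le_trans (le_normr_Rintegral _ (bmeas_integrable mu bhf))) => //.
rewrite mulrAC -Rintegral_cst//; apply: le_Rintegral => //.
- by apply: bmeas_integrable; exact: bmeas_norm.
- exact: finite_measure_integrable_cst.
move=> y _; rewrite !normrM; case: (leP y x) => yx; last first.
  by rewrite normr0 mulr0 !mulr_ge0//; exact: below_ge0.
by rewrite normr1 mulr1 -mulrA ler_pM// fluxle.
Qed.

(** The last clause holds for every Picard iterate because [volterra] preserves nonnegativity, and
    it passes to the limit; [shooting] needs it for the sign of a denominator. *)
Lemma volterra_solvable phi : @bmeas _ T R phi -> exists u, [/\ @bmeas _ T R u,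
  forall x, u x = phi x + volterra u x &
  (forall x, 0 <= phi x) -> forall x, phi x <= u x].
Proof.
move=> bphi; have [c c0 volc] := volterra_bound.
have [mphi [M phiM]] := bphi; have M0 : 0 <= M by exact: le_trans (phiM 0).
pose v := fix v n := if n is m.+1 then (fun x => phi x + volterra (v m) x) else phi.
have bv n : @bmeas _ T R (v n).
  by elim: n => [//|n IH] /=; apply: bmeasD => //; exact: bmeas_volterra.
pose s := fine (nu setT).
have s0 : 0 <= s by exact: fine_ge0.
(* The zeroth iterate is [phi], so the [n]-th increment already contains [n + 1] applications of
   [volterra]: hence [chain nu n.+1]. *)
have vd n x : `|v n.+1 x - v n x| <= M * c * c ^+ n * chain nu n.+1 x.
  elim: n x => [|n IH] x.
    rewrite /= addrC addKr (le_trans (volc _ _ bphi))// expr0 mulr1.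
    rewrite (mulrC M) -mulrA ler_wpM2l// /below -RintegralZl//; last first.
      by apply: integrable_lt; exact: finite_measure_integrable_cst.
    apply: le_Rintegral => //.
    - by apply: integrable_lt; apply: bmeas_integrable; exact: bmeas_norm.
    - apply: bmeas_integrable; apply: bmeasM; first exact: bmeas_cst.
      by apply: bmeasM; [exact: bmeas_cst|exact: bmeas_lt].
    - by move=> z _; rewrite mul1r ler_wpM2r.
  have -> : v n.+2 x - v n.+1 x = volterra (fun z => v n.+1 z + -1 * v n z) x.
    by rewrite volterra_lin// mulN1r /= opprD addrACA subrr add0r.
  have bd : @bmeas _ T R (fun z => v n.+1 z + -1 * v n z).
    by apply: bmeasD => //; apply: bmeasM => //; exact: bmeas_cst.
  rewrite (le_trans (volc _ _ bd))//.
  have -> : M * c * c ^+ n.+1 * chain nu n.+2 x = c * (M * c * c ^+ n * chain nu n.+2 x).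
    by rewrite exprS; ring.
  rewrite ler_wpM2l//.
  rewrite [chain _ _ _]/= /below -RintegralZl//; last first.
    by apply: integrable_lt; apply: bmeas_integrable; exact: (bmeas_chain nu n.+1).
  apply: le_Rintegral => //.
  - by apply: integrable_lt; apply: bmeas_integrable; exact: bmeas_norm.
  - apply: bmeas_integrable; apply: bmeasM; first exact: bmeas_cst.
    by apply: bmeasM; [exact: (bmeas_chain nu n.+1)|exact: bmeas_lt].
  - by move=> z _; rewrite mulrA ler_wpM2r// mulN1r IH.
(* [M] times the terms of the exponential series of [c * s] from index 1 on. *)
pose e n : R := M * exp_coeff (c * s) n.+1.
have vde n x : `|v n.+1 x - v n x| <= e n.
  rewrite (le_trans (vd n x))// -(mulrA M) -exprS /e /exp_coeff/= exprMn.
  rewrite -!mulrA !ler_wpM2l ?exprn_ge0//. exact: (chain_le nu n.+1 x).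
have e0 n : 0 <= e n by rewrite mulr_ge0// exp_coeff_ge0// mulr_ge0.
have ce : cvgn (series e).
  have -> : series e = (fun n => M * (series (exp_coeff (c * s)) n.+1 - 1)).
    apply/funext => n; rewrite seriesEnat/= seriesEnat/= /e -mulr_sumr; congr (M * _).
    by rewrite [in RHS]big_nat_recl//= {2}/exp_coeff/= expr0 fact0 divr1 addrAC subrr add0r.
  apply: is_cvgMr; apply: is_cvgB; last exact: is_cvg_cst.
  have /cvg_ex[l cl] := is_cvg_series_exp_coeff (c * s).
  by apply/cvg_ex; exists l; rewrite (cvg_shiftS (series (exp_coeff (c * s)))).
have cv x : cvgn (v ^~ x).
  have : cvgn (series (fun n => v n.+1 x - v n x)).
    apply: normed_cvg; apply: series_le_cvg ce => // n /=; [exact: normr_ge0|exact: vde].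
  have -> : series (fun n => v n.+1 x - v n x) = (fun n => v n x - phi x).
    by apply/funext => n; rewrite seriesEnat/= telescope_sumr.
  move=> cvd; have -> : v ^~ x = (fun n => (v n x - phi x) + phi x).
    by apply/funext => n; rewrite subrK.
  by apply: is_cvgD => //; exact: is_cvg_cst.
pose E := limn (series e).
have vE n x : `|v n x| <= M + E.
  have -> : v n x = phi x + \sum_(0 <= i < n) (v i.+1 x - v i x).
    by rewrite telescope_sumr// subrKC.
  rewrite (le_trans (ler_normD _ _))// lerD//.
  rewrite (le_trans (ler_norm_sum _ _ _))//.
  apply: le_trans (_ : series e n <= _).
    by rewrite seriesEnat/=; apply: ler_sum => i _; exact: vde.
  apply: nondecreasing_cvgn_le => //; exact: nondecreasing_series.
pose u x := limn (v ^~ x).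
have vu x : v n x @[n --> \oo] --> u x by exact: cv.
have bu : @bmeas _ T R u.
  split.
    apply: measurable_fun_pointwise_cvg vu.
    by move=> n; have [] := bv n.
  exists (M + E) => x.
  by apply: (cvgr_to_le (cvg_norm (vu x))); apply: nearW => n; exact: vE.
exists u; split => // [x|phi0 x]; last first.
  apply: (cvgr_to_ge (vu x)); apply: nearW => n.
  suff : forall x, 0 <= v n x - phi x by move=> /(_ x); rewrite subr_ge0.
  elim: n => [|n IH] {}x /=; first by rewrite subrr.
  rewrite addrC addKr; apply: volterra_ge0 => z.
  by rewrite -[v n z](subrK (phi z)) addr_ge0.
have bd n : @bmeas _ T R (fun z => u z + -1 * v n z).
  by apply: bmeasD => //; apply: bmeasM => //; exact: bmeas_cst.
(* By linearity and [volterra_bound], convergence along the iterates reduces to dominated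
   convergence for [nu] alone, with dominating constant [2 * (M + E)]. *)
have vTu : volterra (v n) x @[n --> \oo] --> volterra u x.
  have cd : below nu (fun z => `|u z + -1 * v n z|) x @[n --> \oo] --> 0.
    have -> : 0 = \int[nu]_(z in setT) (cst 0 z : R) by rewrite Rintegral_cst// mul0r.
    apply: (Rdominated_convergence (g := cst (2 * (M + E)))) => //.
    - move=> n; have [] // : @bmeas _ T R (fun z => `|u z + -1 * v n z| * (z < x)%R%:R).
      by apply: bmeasM; [exact: bmeas_norm|exact: bmeas_lt].
    - exact: finite_measure_integrable_cst.
    - move=> z; rewrite -(mul0r (z < x)%R%:R); apply: cvgM; last exact: cvg_cst.
      rewrite -(normr0 R); apply: cvg_norm; rewrite -(subrr (u z)).
      apply: cvgD; first exact: cvg_cst.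
      by rewrite -[- u z]mulN1r; apply: cvgM; [exact: cvg_cst|exact: vu].
    - move=> n z /=; rewrite normrM normr_id mulrDl mul1r.
      have uz : `|u z| <= M + E.
        by apply: (cvgr_to_le (cvg_norm (vu z))); apply: nearW => m; exact: vE.
      apply: (@le_trans _ _ `|u z + -1 * v n z|).
        by rewrite ler_piMr//; case: (_ < _); rewrite ?normr1 ?normr0.
      by rewrite (le_trans (ler_normD _ _))// lerD// mulN1r normrN.
  apply/cvgrPdist_le => eps eps0.
  have : c * below nu (fun z => `|u z + -1 * v n z|) x @[n --> \oo] --> 0.
    by rewrite -(mulr0 c); apply: cvgM => //; exact: cvg_cst.
  move/cvgrPdist_le => /(_ _ eps0); apply: filterS => n.
  rewrite sub0r normrN => /(le_trans (ler_norm _)); apply: le_trans.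
  by have := volc _ x (bd n); rewrite volterra_lin// mulN1r.
have cu : v n.+1 x @[n --> \oo] --> u x by rewrite (cvg_shiftS (v ^~ x)).
exact: (cvg_unique _ cu (cvgD (cvg_cst (phi x)) vTu)).
Qed.

End volterra.

(** * One-sided limits of primitives *)

Section regularity.
Context (R : realType).
Local Notation T := (measurableTypeR R).
Variables (mu : {finite_measure set T -> \bar R}) (f : R -> R).
Hypothesis intf : mu.-integrable setT (EFin \o f).

(** Along a sequence approaching [x] strictly from one side the indicator of [y <= u n] is
    eventually constant: it becomes that of [y <= x] from the right and of [y < x] from the left.
    Dominated convergence applies with the norm of [f]. *)
Let cvg_upto (u : nat -> R) (x : R) (e : R -> bool) :
  (forall y, \forall n \near \oo, (y <= u n) = e y) ->
  upto mu f (u n) @[n --> \oo] --> \int[mu]_y (f y * (e y)%:R).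
Proof.
move=> ue; apply: (@Rdominated_convergence _ T _ mu (fun n y => f y * (y <= u n)%R%:R)
  (fun y => f y * (e y)%:R) (fun y => `|f y|)).
- move=> n; apply/measurable_EFinP; exact: (measurable_int _ (integrable_le (u n) intf)).
- exact: integrable_norm intf.
- move=> y; apply: cvg_near_cst; by apply: filterS (ue y) => n ->.
- by move=> n y; rewrite normrM; case: (y <= u n); rewrite ?normr1 ?normr0 ?mulr1// mulr0.
Qed.

Lemma upto_right_continuous x : upto mu f @ x^'+ --> upto mu f x.
Proof.
apply/cvg_at_rightP => u [xu ux]; apply: cvg_upto => // y.
case: (leP y x) => yx; first by apply: nearW => n; rewrite (le_trans yx)// ltW.
by apply: filterS (cvgr_lt x ux y yx) => n; rewrite leNgt => ->.
Qed.

Lemma upto_left_limit x : cvg (upto mu f @ x^'-).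
Proof.
apply/cvg_ex; exists (\int[mu]_y (f y * (y < x)%R%:R)).
apply/cvg_at_leftP => u [xu ux]; apply: cvg_upto => // y.
case: (ltP y x) => yx; last by apply: nearW => n; rewrite leNgt (lt_le_trans (xu n)).
by apply: filterS (cvgr_gt x ux y yx) => n /ltW.
Qed.

End regularity.

(** * Densities are determined by their half-line integrals *)

Section density.
Context (R : realType).
Local Notation T := (measurableTypeR R).

(** The measurable sets over which [G] integrates to zero form a Dynkin system; the vanishing total
    integral gives stability under complements. It contains the open right rays, which are stable
    under intersection and generate the Borel sets. *)
Lemma upto_eq0 (mu : {finite_measure set T -> \bar R}) (G : R -> R) :
  mu.-integrable setT (EFin \o G) -> (forall x, upto mu G x = 0) ->
  \int[mu]_y G y = 0 -> ae_eq mu setT G (cst 0).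
Proof.
move=> intG G0 GT.
have eG A : measurable A -> (\int[mu]_(x in A) (G x)%:E)%E = (\int[mu]_(x in A) G x)%:E.
  move=> mA; rewrite /Rintegral fineK//; apply: integrable_fin_num => //.
  exact: integrableS intG.
suff H (A : set T) : measurable A -> \int[mu]_(x in A) G x = 0.
  have : ae_eq mu setT (EFin \o G) (cst 0%E).
    apply: integral_ae_eq => // A _ mA; rewrite integral0.
    by have /= -> := eG A mA; rewrite H.
  by apply: filterS => x /(_ I) [Gx] _.
have mE := RGenOInfty.measurableE R; rewrite [X in X A -> _]mE.
have upE x : \int[mu]_(y in `]-oo, x]) G y = 0.
  rewrite -[RHS](G0 x) Rintegral_mkcond; apply: eq_Rintegral => y _.
  rewrite patchE; case: ifPn; rewrite ?inE ?notin_setE /= in_itv/=.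
    by move=> ->; rewrite mulr1.
  by move/negP/negbTE => ->; rewrite mulr0.
move: A; apply: (@dynkin_induction _ T (@RGenOInfty.G R)
  (fun A => \int[mu]_(x in A) G x = 0)) => //.
- move=> _ _ [x ->] [y ->]; exists (Num.max x y).
  by apply/seteqP; split => z /=; rewrite !in_itv/= !andbT gt_max => /andP.
- move=> _ [x ->]; have := @Rintegral_setU _ _ _ mu `]-oo, x]%classic `]x, +oo[%classic G.
  rewrite -setCitvl setUv GT upE add0r => H; apply/esym/H => //.
    exact: measurableC.
  by apply/disj_setPS; rewrite setICr.
- move=> S mS S0.
  have := @Rintegral_setU _ _ _ mu S (~` S) G mS (measurableC mS).
  rewrite setUv S0 add0r GT => H; apply/esym/H => //.
  by apply/disj_setPS; rewrite setICr.
- move=> F mF tF F0; rewrite /Rintegral integral_bigcup//; last first.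
    apply: integrableS intG => //; exact: bigcupT_measurable.
  by rewrite eseries0// => i _ _; have /= -> := eG _ (mF i); rewrite F0.
Qed.

End density.

(** * The shooting method and integration by parts *)

Section shooting.
Context (R : realType).
Local Notation T := (measurableTypeR R).
Variables (mu nu : {finite_measure set T -> \bar R}) (h k beta : R -> R).
Hypotheses (bh : @bmeas _ T R h) (bk : @bmeas _ T R k).
Hypotheses (h0 : forall x, 0 <= h x) (k0 : forall x, 0 <= k x).
Hypothesis ibeta : mu.-integrable setT (EFin \o beta).
Hypothesis hpos : 0 < \int[mu]_y h y.

Definition slope (c : R) (u : R -> R) (y : R) : R :=
  h y * (c - beta y + flux nu k u y).

Lemma shooting : exists c u, [/\ @bmeas _ T R u,
  forall x, u x = upto mu (slope c u) x & \int[mu]_y slope c u y = 0].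
Proof.
have ihb : mu.-integrable setT (EFin \o (fun y => h y * beta y)).
  exact: bmeasM_integrable.
have ih := bmeas_integrable mu bh.
(* The solution is sought as [A + c * B]: [A] is forced by the noise alone, through minus the
   primitive of [h * beta], and [B] by the primitive of [h], the response to a unit constant. *)
have [A [bA eA _]] := volterra_solvable mu nu bh bk h0 k0
  (@bmeasM _ _ _ _ _ (@bmeas_cst _ T R (-1)) (bmeas_upto ihb)).
have [B [bB eB /(_ _) B1]] := volterra_solvable mu nu bh bk h0 k0 (bmeas_upto ih).
have bhf u : @bmeas _ T R u -> @bmeas _ T R (fun y => h y * flux nu k u y).
  by move=> bu; apply: bmeasM => //; exact: bmeas_flux.
have B0 x : 0 <= B x.
  have p0 y : 0 <= upto mu h y by apply: Rintegral_ge0 => z _; rewrite mulr_ge0.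
  by rewrite (le_trans (p0 x))// B1.
have slopeE c y : slope c (fun x => A x + c * B x) y =
    (h y * flux nu k A y + -1 * (h y * beta y)) + c * (h y + 1 * (h y * flux nu k B y)).
  by rewrite /slope flux_lin//; ring.
have i1 : mu.-integrable setT (EFin \o (fun y => h y * flux nu k A y + -1 * (h y * beta y))).
  by apply: integrable_lin => //; apply: bmeas_integrable; exact: bhf.
have i2 : mu.-integrable setT (EFin \o (fun y => h y + 1 * (h y * flux nu k B y))).
  by apply: integrable_lin => //; apply: bmeas_integrable; exact: bhf.
pose a := \int[mu]_y (h y * flux nu k A y + -1 * (h y * beta y)).
pose b := \int[mu]_y (h y + 1 * (h y * flux nu k B y)).
have b0 : 0 < b.
  apply: (lt_le_trans hpos); apply: le_Rintegral => // y _.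
  rewrite mul1r lerDl mulr_ge0//; apply: below_ge0 => z.
  by rewrite mulr_ge0.
pose c := - a / b; exists c, (fun x => A x + c * B x); split.
- by apply: bmeasD => //; apply: bmeasM => //; exact: bmeas_cst.
- move=> x; rewrite (funext (slopeE c)) upto_lin// upto_lin//; last first.
    by apply: bmeas_integrable; exact: bhf.
  rewrite upto_lin//; last by apply: bmeas_integrable; exact: bhf.
  by rewrite eA eB /volterra /=; ring.
- rewrite (funext (slopeE c)) RintegralD//; last first.
    by have := integrableZl measurableT c i2; apply: eq_integrable.
  by rewrite RintegralZl// -/a -/b /c divfK ?gt_eqF// subrr.
Qed.

(** Integration by parts for a pair of measures. Fubini's theorem pairs [G y] with the integral of
    [w] over [y <= x], that is the total integral minus [below nu w y]; the zero mean of [G] kills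
    the total, so no boundary term is left. *)
Lemma weak_form (w G : R -> R) : @bmeas _ T R w ->
  mu.-integrable setT (EFin \o G) -> \int[mu]_y G y = 0 ->
  \int[nu]_x (w x * upto mu G x) = - \int[mu]_y (below nu w y * G y).
Proof.
move=> bw iG G0; have iw := bmeas_integrable nu bw.
transitivity (\int[nu]_x \int[mu]_y (w x * (G y * (y <= x)%R%:R))).
  by apply: eq_Rintegral => x _; rewrite RintegralZl//; exact: integrable_le.
have mG : measurable_fun setT (G : T -> R).
  by apply/measurable_EFinP; exact: (measurable_int _ iG).
have mw : measurable_fun setT (w : T -> R) by case: bw.
rewrite (dominated_Fubini (m1 := nu) (m2 := mu)
    (f := fun p => w p.1 * (G p.2 * (p.2 <= p.1)%R%:R)) (a := w) (b := G)) //; last 2 first.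
- apply: measurable_funM; first exact: measurableT_comp.
  apply: measurable_funM; first exact: measurableT_comp.
  by have [] := @bmeas_bool _ _ R _ (@measurable_le2 R).
- move=> x y /=; rewrite !normrM; case: (y <= x); rewrite ?normr1 ?mulr1//.
  by rewrite normr0 !mulr0 mulr_ge0.
have ibG : mu.-integrable setT (EFin \o (fun y => below nu w y * G y)).
  by apply: bmeasM_integrable => //; exact: bmeas_below.
transitivity (\int[mu]_y ((\int[nu]_x w x) * G y + -1 * (below nu w y * G y))).
  apply: eq_Rintegral => y _ /=.
  transitivity (\int[nu]_x ((w x - w x * (x < y)%R%:R) * G y)).
    apply: eq_Rintegral => x _.
    rewrite /= leNgt; case: (x < y) => /=.
      by rewrite mulr1 subrr mul0r !mulr0.
    by rewrite mulr0 subr0 mulr1.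
  rewrite RintegralZr//; last first.
    have := integrable_lin (-1) iw (integrable_lt y iw).
    by apply: eq_integrable => // x _ /=; rewrite mulN1r.
  by rewrite RintegralB//; [rewrite mulrBl mulN1r|exact: integrable_lt].
rewrite RintegralD//; last 2 first.
- by have := integrableZl measurableT (\int[nu]_x w x) iG; apply: eq_integrable.
- by have := integrableZl measurableT (-1) ibG; apply: eq_integrable.
by rewrite !RintegralZl// G0 mulr0 add0r mulN1r.
Qed.

End shooting.

(** * Functions on the circle *)

Section square_integrable.
Context d (T : measurableType d) (R : realType).
Implicit Types f g : T -> R.

Definition sqint (mu : {measure set T -> \bar R}) f :=
  measurable_fun setT f /\ mu.-integrable setT (EFin \o (fun x => f x ^+ 2)).

Lemma Lfun2P (mu : {measure set T -> \bar R}) f : f \in Lfun mu 2%:E <-> sqint mu f.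
Proof.
split=> [Lf|[mf /integrable_lty int2]].
  split; last exact: Lfun2_integrable_sqr.
  by move: Lf; rewrite inE => /andP[]; rewrite inE.
rewrite inE; apply/andP; split; rewrite inE//= /finite_norm unlock.
apply: poweR_lty; rewrite [ltLHS](_ : _ = \int[mu]_x ((f x ^+ 2)%:E))%E; first exact: int2.
by apply: eq_integral => x _; rewrite /= powR_mulrn// real_normK// num_real.
Qed.

Lemma le_sqint (mu : {measure set T -> \bar R}) f g : measurable_fun setT f ->
  sqint mu g -> (forall x, `|f x| <= `|g x|) -> sqint mu f.
Proof.
move=> mf [mg ig] fg; split => //.
apply: le_integrable ig => //; first by apply/measurable_EFinP; exact: measurable_funX.
by move=> x _ /=; rewrite lee_fin !normrX ler_pXn2r// nnegrE.
Qed.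

Lemma sqintM (mu : {measure set T -> \bar R}) f g : sqint mu f -> sqint mu g ->
  mu.-integrable setT (EFin \o (fun x => f x * g x)).
Proof.
move=> [mf f2] [mg g2]; apply: le_integrable (integrableD measurableT f2 g2) => //.
  by apply/measurable_EFinP; exact: measurable_funM.
move=> x _ /=; rewrite lee_fin normrM [leRHS]ger0_norm ?addr_ge0 ?sqr_ge0//.
rewrite -(real_normK (num_real (f x))) -(real_normK (num_real (g x))).
have := sqr_ge0 (`|f x| - `|g x|); have := mulr_ge0 (normr_ge0 (f x)) (normr_ge0 (g x)).
by rewrite sqrrB; lra.
Qed.

Lemma sqintD (mu : {measure set T -> \bar R}) f g : sqint mu f -> sqint mu g ->
  sqint mu (fun x => f x + g x).
Proof.
move=> sf sg; split; first by apply: measurable_funD; [case: sf|case: sg].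
have i1 := integrableD measurableT (proj2 sf) (proj2 sg).
have i2 := integrableZl measurableT 2 (sqintM sf sg).
have := integrableD measurableT i1 i2.
apply: eq_integrable => // x _ /=; rewrite -EFinM -!EFinD; congr EFin; ring.
Qed.

Variable mu : {finite_measure set T -> \bar R}.

Lemma bmeas_sqint f : bmeas f -> sqint mu f.
Proof.
move=> bf; split; first by case: bf.
by apply: bmeas_integrable; exact: (bmeasM bf bf).
Qed.

Lemma bmeasM_sqint f g : bmeas f -> sqint mu g -> sqint mu (fun x => f x * g x).
Proof.
move=> bf [mg ig]; split; first by apply: measurable_funM => //; case: bf.
have := bmeasM_integrable (bmeasM bf bf) ig; apply: eq_integrable => // x _ /=.
by rewrite exprMn.
Qed.

Lemma sqint_integrable f : sqint mu f -> mu.-integrable setT (EFin \o f).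
Proof.
move=> sf; have := sqintM sf (bmeas_sqint (@bmeas_cst _ T R 1)).
by apply: eq_integrable => // x _ /=; rewrite mulr1.
Qed.

Lemma sqintB f g : sqint mu f -> sqint mu g -> sqint mu (fun x => f x - g x).
Proof.
move=> sf sg; have := sqintD sf (bmeasM_sqint (@bmeas_cst _ T R (-1)) sg).
by congr sqint; apply/funext => x; rewrite mulN1r.
Qed.

End square_integrable.

Lemma ae_eq_Rintegral d (T : measurableType d) (R : realType)
    (mu : {measure set T -> \bar R}) (f g : T -> R) :
  measurable_fun setT f -> measurable_fun setT g -> ae_eq mu setT f g ->
  \int[mu]_x f x = \int[mu]_x g x.
Proof.
move=> mf mg fg; rewrite /Rintegral; congr fine.
apply: ae_eq_integral => //; [exact/measurable_EFinP..|].
by apply: filterS fg => x fg /fg ->.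
Qed.

(** * Restriction to a set of finite measure *)

Section restricted_measure.
Context d (T : measurableType d) (R : realType).
Variables (m : {measure set T -> \bar R}) (D : set T).
Hypotheses (mD : measurable D) (mDoo : (m D < +oo)%E).
Local Notation mu := (mfrestr mD mDoo).
Implicit Types f g : T -> R.

Lemma integral_mfrestr (E : set T) (f : T -> \bar R) : E `<=` D ->
  (\int[m]_(x in E) f x = \int[mu]_(x in E) f x)%E.
Proof.
move=> ED; apply: eq_measure_integral => A mA AE.
by rewrite /= /mfrestr /mrestr setIidl//; exact: subset_trans ED.
Qed.

Lemma Rintegral_mfrestr (E : set T) f : E `<=` D ->
  \int[m]_(x in E) f x = \int[mu]_x (f \_ E) x.
Proof. by move=> ED; rewrite -[RHS]Rintegral_mkcond /Rintegral integral_mfrestr. Qed.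

Lemma sqint_mfrestr f : sqint m (f \_ D) <-> sqint mu (f \_ D).
Proof.
have sqD : (EFin \o (fun x => (f \_ D) x ^+ 2)) = (EFin \o (fun x => f x ^+ 2)) \_ D.
  rewrite restrict_EFin; apply/funext => x /=; rewrite !patchE.
  by case: ifP; rewrite // expr0n.
have iff : measurable_fun setT (f \_ D) ->
    m.-integrable setT (EFin \o (fun x => (f \_ D) x ^+ 2)) <->
    mu.-integrable setT (EFin \o (fun x => (f \_ D) x ^+ 2)).
  move=> mf; rewrite sqD -!integrable_mkcond//.
  by split => /integrableP[mf2 i2]; apply/integrableP; split => //;
    move: i2; rewrite integral_mfrestr.
by split => -[mf /(iff mf)].
Qed.

Lemma ae_mfrestr (Q : T -> Prop) :
  {ae m, forall x, D x -> Q x} <-> {ae mu, forall x, D x -> Q x}.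
Proof.
split=> -[N [mN N0 sN]].
  exists N; split => //; apply/eqP; rewrite -measure_le0 -N0.
  by apply: le_measure; rewrite ?inE//; exact: measurableI.
exists (N `&` D); split => //; first exact: measurableI.
move=> x /= nQ; split; first exact: sN.
by apply: contrapT => nD; apply: nQ.
Qed.

End restricted_measure.

(** * The function spaces in terms of finite measures on the line *)

Section drivers.
Context (R : realType) (W : cadlag_driver R) (V : caglad_driver R).
Local Notation T := (measurableTypeR R).
Implicit Types (f F G g : R -> R) (p q : R * (R -> R)).

Definition opencircle : set R := `]0, 1[%classic.

Lemma measurable_opencircle : measurable (opencircle : set T).
Proof. exact: measurable_itv. Qed.

Lemma measurable_circle : measurable (circle : set T).
Proof. exact: measurable_itv. Qed.

Lemma dW_opencircle_fin : (dW W opencircle < +oo)%E.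
Proof.
apply: (@le_lt_trans _ _ (dW W `]0, 1]%classic)); last by rewrite dW_itv ?ltry.
apply: le_measure; rewrite ?inE; try exact: measurable_itv.
by apply: subset_itv; rewrite bnd_simp.
Qed.

Lemma dV_circle_fin : (dV V circle < +oo)%E.
Proof. by rewrite dV_itv ?ltry. Qed.

(* The point 0 is dW-null (dW_set0), so nothing is lost by restricting dW to the
   open interval; integrals over (0, x] then become integrals over half-lines. *)
Definition muW : {finite_measure set T -> \bar R} :=
  mfrestr measurable_opencircle dW_opencircle_fin.

Definition nuV : {finite_measure set T -> \bar R} :=
  mfrestr measurable_circle dV_circle_fin.

(** Continuity of [W] at 0: the point lies in intervals []- (r / 2), 0]], whose mass
    [- W (- (r / 2))] is as small as desired. *)
Lemma dW_set0 : dW W [set 0] = 0%E.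
Proof.
apply/eqP; rewrite eq_le measure_ge0 andbT.
apply/lee_addgt0Pr => e e0; rewrite add0e.
have /cvgrPdist_le/(_ e e0) := @W_continuous0 _ W.
rewrite W0 => -[r /= r0 /(_ (- (r / 2)))] Wr.
have r2 : 0 < r / 2 by rewrite divr_gt0.
apply: (@le_trans _ _ (dW W `]- (r / 2), 0]%classic)).
  apply: le_measure; rewrite ?inE//.
  by move=> _ -> /=; rewrite in_itv/= lexx oppr_lt0 r2.
rewrite dW_itv; last by rewrite oppr_le0 ltW.
rewrite lee_fin W0.
apply: (le_trans (ler_norm _)); apply: Wr.
by rewrite /= sub0r opprK gtr0_norm// ltr_pdivrMr// ltr_pMr// ltr1n.
Qed.

Lemma opencircle_circle : opencircle `<=` circle.
Proof. by apply: subset_itv; rewrite bnd_simp. Qed.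

Lemma measurable_circleP f :
  measurable_fun setT (f \_ opencircle : T -> R) <->
  measurable_fun setT (f \_ circle : T -> R).
Proof.
have e1 := @measurable_restrictT _ _ T R opencircle f measurable_opencircle.
have e2 := @measurable_restrictT _ _ T R circle f measurable_circle.
have e3 := @measurable_fun_itv_obnd_cbndP R 0 (BLeft 1) f.
by split=> [/e1 /e3 /e2|/e2 /e3 /e1].
Qed.

Lemma RintegralW f : measurable_fun setT (f \_ circle : T -> R) ->
  \int[dW W]_(x in circle) f x = \int[muW]_x (f \_ opencircle) x.
Proof.
move=> mf; transitivity (\int[dW W]_(x in opencircle) f x); last first.
  exact: Rintegral_mfrestr.
have cE : circle = [set 0] `|` opencircle :> set R by rewrite /opencircle setU1itv// bnd_simp ltr01.
rewrite /Rintegral cE integral_setU_EFin//; first last.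
- by apply/disj_setPS => x [/= ->]; rewrite /opencircle /= in_itv/= ltxx.
- by rewrite -cE; exact: (@measurable_restrictT _ _ T R circle f measurable_circle).2.
- exact: measurable_opencircle.
by rewrite null_set_integral ?add0e//; [exact/measurable_EFinP/measurable_fun_set1|exact: dW_set0].
Qed.

Lemma RintegralW_upto f x : x < 1 ->
  \int[dW W]_(y in `]0, x]) f y = upto muW (f \_ opencircle) x.
Proof.
move=> x1; rewrite (Rintegral_mfrestr measurable_opencircle dW_opencircle_fin).
  apply: eq_Rintegral => y _; rewrite !patchE.
  have -> : (y \in [set` `]0, x]]) = (y \in opencircle) && (y <= x).
    rewrite /opencircle !mem_setE !in_itv/=; case: (ltP 0 y) => //= y0.
    by case: (leP y x) => yx; rewrite ?andbF// andbT (le_lt_trans yx x1).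
  by case: (y \in opencircle); case: (y <= x); rewrite /= ?mulr1 ?mulr0.
move=> y; rewrite /opencircle /= !in_itv/= => /andP[-> yx].
exact: le_lt_trans x1.
Qed.

Lemma RintegralV f : \int[dV V]_(x in circle) f x = \int[nuV]_x (f \_ circle) x.
Proof. exact: Rintegral_mfrestr. Qed.

Lemma L2_WP F : L2_W W F <-> sqint muW (F \_ opencircle).
Proof.
rewrite /L2_W Lfun2P; rewrite -(sqint_mfrestr measurable_opencircle dW_opencircle_fin).
have E : F \_ circle = (fun x => (F \_ [set 0]) x + (F \_ opencircle) x).
  apply/funext => x; rewrite !patchE /opencircle !mem_setE !in_itv/=.
  have [->|x0] := eqVneq x 0.
    by rewrite lexx ltr01 ltxx addr0 mem_set.
  rewrite [x \in [set 0]]memNset; last exact/eqP.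
  by rewrite [0 < x]lt_neqAle [0 == x]eq_sym x0/= add0r.
have s0 : sqint (dW W) (F \_ [set 0]).
  have m0 : measurable_fun setT (F \_ [set 0] : T -> R).
    apply: (@measurable_restrictT _ _ T R [set 0] F (measurable_set1 0)).1.
    exact: measurable_fun_set1.
  split => //.
  have -> : EFin \o (fun x => (F \_ [set 0]) x ^+ 2) =
      (EFin \o (fun x => F x ^+ 2)) \_ [set 0].
    rewrite restrict_EFin; apply/funext => x /=; rewrite !patchE.
    by case: ifP; rewrite // expr0n.
  apply: (@integrable_mkcond _ T R (dW W) [set 0]
    (EFin \o (fun x => F x ^+ 2)) (measurable_set1 0)).1.
  apply: null_set_integrable => //.
    exact: measurable_fun_set1.
  exact: dW_set0.
split=> [s|s]; last by rewrite E; exact: sqintD.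
have mo : measurable_fun setT (F \_ opencircle : T -> R).
  by apply/measurable_circleP; case: s.
apply: (le_sqint mo s) => x; rewrite !patchE.
case: ifPn; last by rewrite normr0.
by rewrite inE => /opencircle_circle /mem_set ->.
Qed.

Lemma L2_VP f : L2_V V f <-> sqint nuV (f \_ circle).
Proof. by rewrite /L2_V Lfun2P -sqint_mfrestr. Qed.

Lemma upto_opencircle0 f x : x <= 0 -> upto muW (f \_ opencircle) x = 0.
Proof.
move=> x0; rewrite -[RHS](mul0r (fine (muW setT))) -Rintegral_cst//.
apply: eq_Rintegral => y _.
rewrite patchE /opencircle; case: ifPn; last by rewrite mul0r.
by rewrite inE/= in_itv/= => /andP[y0 _]; rewrite (lt_geF (le_lt_trans x0 y0)) mulr0.
Qed.

Lemma upto_opencircle1 f x : 1 <= x ->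
  upto muW (f \_ opencircle) x = \int[muW]_y (f \_ opencircle) y.
Proof.
move=> x1; apply: eq_Rintegral => y _.
rewrite patchE /opencircle; case: ifPn; last by rewrite mul0r.
by rewrite inE/= in_itv/= => /andP[_ y1]; rewrite ltW ?mulr1// (lt_le_trans y1).
Qed.

Lemma primitiveE p x : circle x ->
  primitive W p x = p.1 + upto muW (p.2 \_ opencircle) x.
Proof.
by rewrite /circle/= in_itv/= => /andP[_ x1]; rewrite /primitive RintegralW_upto.
Qed.

Lemma representsP f p : represents W V f p <->
  [/\ sqint muW (p.2 \_ opencircle), \int[muW]_x (p.2 \_ opencircle) x = 0 &
      {ae nuV, forall x, circle x -> f x = p.1 + upto muW (p.2 \_ opencircle) x}].
Proof.
have E : (f = primitive W p %[ae dV V in circle]) <->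
    {ae nuV, forall x, circle x -> f x = p.1 + upto muW (p.2 \_ opencircle) x}.
  have FV : Filter (almost_everywhere (dV V)) by exact: ae_filter_ringOfSetsType.
  rewrite -ae_mfrestr; split; apply: filterS => x fx cx;
    by rewrite (fx cx) primitiveE.
have Ri : sqint muW (p.2 \_ opencircle) ->
    \int[dW W]_(x in circle) p.2 x = \int[muW]_x (p.2 \_ opencircle) x.
  by move=> [mp _]; apply: RintegralW; exact/measurable_circleP.
split=> [[/L2_WP s i /E e]|[s i /E e]]; split => //; first by rewrite -Ri.
  exact/L2_WP.
by rewrite Ri.
Qed.

(* Since V is strictly increasing, every interval [x, x + r) has positive mass,
   so a function that vanishes V-almost everywhere vanishes on a sequence
   decreasing to x. *)
Lemma ae_right_continuous_eq0 f (x : R) : circle x -> f @ x^'+ --> f x ->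
  {ae nuV, forall y, circle y -> f y = 0} -> f x = 0.
Proof.
move=> cx fc [N [mN N0 sN]]; apply: contrapT => /eqP fx.
have f0 : 0 < `|f x| by rewrite normr_gt0.
have /cvgrPdist_lt/(_ _ f0)[r /= r0 fr] := fc.
have /andP[x0 x1] : 0 <= x < 1 by move: cx; rewrite /circle/= in_itv.
pose z := Num.min (x + r) 1.
have xz : x < z by rewrite lt_min ltrDl r0.
have : (nuV `[x, z[%classic <= nuV N)%E.
  apply: le_measure; rewrite ?inE// => y; rewrite /= in_itv/= => /andP[xy yz].
  apply: sN => /= H.
  have cy : circle y.
    rewrite /circle/= in_itv/= (le_trans x0 xy)/=.
    by move: yz; rewrite lt_min => /andP[].
  move: xy; rewrite le_eqVlt => /predU1P[xy|xy].
    by move: fx; rewrite xy (H cy) eqxx.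
  have : `|f x - f y| < `|f x|.
    apply: fr => //=; rewrite distrC gtr0_norm ?subr_gt0// ltrBlDl.
    by move: yz; rewrite lt_min => /andP[].
  by rewrite (H cy) subr0 ltxx.
rewrite N0 /= /mfrestr /mrestr setIidl; last first.
  move=> y /=; rewrite in_itv/= => /andP[xy]; rewrite lt_min => /andP[_ y1].
  by rewrite /circle/= in_itv/= (le_trans x0 xy).
rewrite dV_itv; last exact: ltW.
by rewrite lee_fin subr_le0 leNgt V_increasing.
Qed.

(** This justifies the choice made by [repr_pair]. The difference of the two càdlàg primitives
    vanishes almost everywhere, hence everywhere on the circle by right-continuity; its value at 0
    compares the constants, and [upto_eq0] then compares the densities. *)
Lemma represents_unique f p q : represents W V f p -> represents W V f q ->
  p.1 = q.1 /\ ae_eq muW setT (p.2 \_ opencircle) (q.2 \_ opencircle).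
Proof.
move=> /representsP[sp ip fp] /representsP[sq iq fq].
have Ip := sqint_integrable sp; have Iq := sqint_integrable sq.
pose G := (fun x => p.2 x - q.2 x) \_ opencircle.
have GE : G = (fun x => (p.2 \_ opencircle) x + -1 * (q.2 \_ opencircle) x).
  apply/funext => x; rewrite /G !patchE; case: ifP => _; first by rewrite mulN1r.
  by rewrite mulr0 addr0.
have IG : muW.-integrable setT (EFin \o G) by rewrite GE; exact: integrable_lin.
have D0 x : circle x -> p.1 - q.1 + upto muW G x = 0.
  move=> cx; apply: (@ae_right_continuous_eq0 (fun x => p.1 - q.1 + upto muW G x)) => //.
    apply: cvgD; first exact: cvg_cst.
    exact: upto_right_continuous.
  have FN : Filter (almost_everywhere nuV) by exact: ae_filter_ringOfSetsType.
  apply: filterS2 fp fq => y fp fq cy.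
  by rewrite GE upto_lin// mulN1r addrACA -opprD -(fp cy) -(fq cy) subrr.
have pq : p.1 = q.1.
  have := D0 0; rewrite upto_opencircle0// addr0 => /(_ _)/subr0_eq -> //.
  by rewrite /circle/= in_itv/= lexx ltr01.
split => //.
have GT : \int[muW]_y G y = 0.
  rewrite GE RintegralD//; last first.
    by have := integrableZl measurableT (-1) Iq; apply: eq_integrable.
  by rewrite RintegralZl// ip iq mulr0 addr0.
have : ae_eq muW setT G (cst 0).
  apply: upto_eq0 => // x.
  have [x0|x0] := leP x 0; first exact: upto_opencircle0.
  have [x1|x1] := leP 1 x; first by rewrite upto_opencircle1.
  have := D0 x; rewrite pq subrr add0r => -> //.
  by rewrite /circle/= in_itv/= x1 ltW.
by apply: filterS => x /(_ I); rewrite GE => /eqP;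
  rewrite mulN1r subr_eq0 => /eqP.
Qed.

Lemma HWVDP g : HWVD W V g -> [/\ sqint nuV (g \_ circle),
  sqint muW (DW W V g \_ opencircle),
  \int[muW]_y (DW W V g \_ opencircle) y = 0 &
  {ae nuV, forall x, circle x -> g x = upto muW (DW W V g \_ opencircle) x}].
Proof.
have c0 : circle (0 : R) by rewrite /circle/= in_itv/= lexx ltr01.
move=> [[/L2_VP Lg [p gp]]].
have /representsP[sG iG gG] : represents W V g (repr_pair W V g).
  exact: (xgetPex _ (ex_intro _ p gp)).
rewrite /cadlag_repr primitiveE// upto_opencircle0// addr0 => g0.
have FN : Filter (almost_everywhere nuV) by exact: ae_filter_ringOfSetsType.
by split => //; apply: filterS gG => x + cx => /(_ cx); rewrite g0 add0r.
Qed.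

(** [DW] returns an unspecified representative, so a derivative found by computation can be matched
    with it only almost everywhere. The slope of the solution and the derivative of a difference of
    solutions enter through this lemma. *)
Lemma HWVD_represents g G : sqint nuV (g \_ circle) ->
  sqint muW (G \_ opencircle) -> \int[muW]_y (G \_ opencircle) y = 0 ->
  {ae nuV, forall x, circle x -> g x = upto muW (G \_ opencircle) x} ->
  HWVD W V g /\ ae_eq muW setT (DW W V g \_ opencircle) (G \_ opencircle).
Proof.
move=> Lg sG iG gG.
have c0 : circle (0 : R) by rewrite /circle/= in_itv/= lexx ltr01.
have FN : Filter (almost_everywhere nuV) by exact: ae_filter_ringOfSetsType.
have r0 : represents W V g (0, G).
  apply/representsP; split => //; apply: filterS gG => x + cx => /(_ cx) ->.
  by rewrite add0r.
have rg : represents W V g (repr_pair W V g).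
  exact: (xgetPex _ (ex_intro _ _ r0)).
have [/= g0 gae] := represents_unique rg r0.
split => //; split; first by split; [exact/L2_VP|exists (0, G)].
by rewrite /cadlag_repr primitiveE// upto_opencircle0// addr0.
Qed.

End drivers.
Arguments opencircle {R}.

(** * Weak solutions *)

Section well_posedness.
Context (R : realType) (W : cadlag_driver R) (V : caglad_driver R).
Local Notation T := (measurableTypeR R).
Local Notation mu := (muW W).
Local Notation nu := (nuV V).
Local Notation "f '|W'" := (f \_ opencircle) (at level 2).
Local Notation "f '|V'" := (f \_ circle) (at level 2).

Variables (kappa H b : R -> R).
Hypotheses (mkappa : measurable_fun (circle : set T) kappa)
  (mH : measurable_fun (circle : set T) H)
  (bkappa : [bounded kappa x | x in circle]) (bH : [bounded H x | x in circle])
  (H0 : bounded_away_from_zero H) (Hpos : forall x, circle x -> 0 < H x).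

(** Each coefficient is extended by zero from the set carrying the measure it is integrated against:
    the half-open circle for dV, the open one for dW. Thus [hH * h = 1] on the open circle only. *)
Let k : R -> R := (fun x => kappa x ^+ 2) |V.
Let hH : R -> R := H |W.
Let h : R -> R := (fun x => (H x)^-1) |W.
Let beta : R -> R := (fun s => lim (b @ s^'-)) |W.

Hypothesis sbeta : sqint mu beta.

Lemma bmeas_restrict (D : set T) (f : R -> R) : measurable D ->
  measurable_fun D f -> [bounded f x | x in D] -> @bmeas _ T R (f \_ D).
Proof.
move=> mD mf [M [_ fM]]; split.
  exact: (@measurable_restrictT _ _ T R D f mD).1.
(* Boundedness supplies a bound for each number exceeding [M], hence [M + 1]; the maximum with 0
   covers the points outside [D]. *)
exists (Num.max (M + 1) 0) => x; rewrite patchE; case: ifPn => [|_].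
  by rewrite inE => Dx; rewrite le_max fM// ltrDl.
by rewrite normr0 le_max lexx orbT.
Qed.

Lemma measurable_opencircleS (f : R -> R) :
  measurable_fun (circle : set T) f -> measurable_fun (opencircle : set T) f.
Proof. 
by move=> mf; apply: measurable_funS mf; [exact: measurable_circle|exact: opencircle_circle].
Qed.

Lemma bmeas_k : @bmeas _ T R k.
Proof.
apply: bmeas_restrict; first exact: measurable_circle.
  exact: measurable_funX.
have [M [Mr kM]] := bkappa; exists ((M + 1) ^+ 2); split; first exact: num_real.
move=> x Mx y cy; have k1 := kM (M + 1) (ltac:(by rewrite ltrDl)) y cy.
rewrite /= (le_trans _ (ltW Mx))// normrX ler_pXn2r// nnegrE//.
exact: le_trans k1.
Qed.

Lemma bmeas_hH : @bmeas _ T R hH.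
Proof.
apply: bmeas_restrict; first exact: measurable_opencircle.
  exact: measurable_opencircleS.
have [M [Mr HM]] := bH; exists M; split => // x Mx y /opencircle_circle.
exact: HM.
Qed.

Lemma bmeas_h : @bmeas _ T R h.
Proof.
apply: bmeas_restrict; first exact: measurable_opencircle.
  apply: measurable_opencircleS.
  apply: (eq_measurable_fun (fun x => H x `^ (-1))).
    by move=> x /set_mem cx; rewrite powR_inv1// ltW// Hpos.
  exact: measurableT_comp (measurable_powR (-1)) mH.
have [c c0 Hc] := H0; exists c^-1; split; first exact: num_real.
move=> x Mx y /opencircle_circle cy; rewrite /= (le_trans _ (ltW Mx))//.
rewrite normfV lef_pV2 ?posrE//; first exact: Hc.
exact: lt_le_trans (Hc _ cy).
Qed.

Lemma k_ge0 x : 0 <= k x.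
Proof. by rewrite /k patchE; case: ifP => // _; exact: sqr_ge0. Qed.

Lemma hH_ge0 x : 0 <= hH x.
Proof.
rewrite /hH patchE; case: ifPn => //.
by rewrite inE => /opencircle_circle /Hpos /ltW.
Qed.

Lemma h_ge0 x : 0 <= h x.
Proof.
rewrite /h patchE; case: ifPn => //.
by rewrite inE => /opencircle_circle /Hpos; rewrite invr_ge0 => /ltW.
Qed.

(** [H] is bounded above, so its inverse is at least [(M + 1)^-1] on the open circle, a set of
    positive mass because it contains []0, 2^-1]] and [W] is strictly increasing. This is the
    positivity that [shooting] requires. *)
Lemma Rintegral_h_gt0 : 0 < \int[mu]_y h y.
Proof.
have [M [_ HM]] := bH; have c12 : circle (2^-1 : R).
  by rewrite /circle/= in_itv/= invr_ge0 ler0n/= invf_lt1// ltr1n.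
have M1 : 0 < M + 1.
  apply: (lt_le_trans (Hpos c12)); apply: (le_trans (ler_norm _)).
  by apply: (HM (M + 1)) => //; rewrite ltrDl.
have mo : (0 < fine (mu opencircle))%R.
  apply: fine_gt0; rewrite ltey_eq fin_num_measure ?andbT//; last exact: measurable_opencircle.
  rewrite /= /mfrestr /mrestr setIid.
  apply: (@lt_le_trans _ _ (dW W `]0, 2^-1]%classic)).
    by rewrite dW_itv ?invr_ge0 ?ler0n// lte_fin subr_gt0 W_increasing// invr_gt0 ltr0n.
  apply: le_measure; rewrite ?inE; [exact: measurable_itv|exact: measurable_opencircle|].
  move=> x; rewrite /opencircle /= !in_itv/= => /andP[-> x2]; rewrite (le_lt_trans x2)//.
  by rewrite invf_lt1// ltr1n.
apply: (@lt_le_trans _ _ (\int[mu]_(y in opencircle) (M + 1)^-1)).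
  rewrite Rintegral_cst; last exact: measurable_opencircle.
  by rewrite mulr_gt0// invr_gt0.
rewrite Rintegral_mkcond; apply: le_Rintegral => //.
- apply: bmeas_integrable; apply: bmeas_restrict; first exact: measurable_opencircle.
    exact: measurable_cst.
  by exists `|(M + 1)^-1|; split => // x /ltW Mx y _.
- by apply: bmeas_integrable; exact: bmeas_h.
move=> y _; rewrite /h !patchE; case: ifPn => // /set_mem /opencircle_circle cy.
rewrite lef_pV2 ?posrE// ?Hpos//; apply: (le_trans (ler_norm _)).
by apply: (HM (M + 1)) => //; rewrite ltrDl.
Qed.

Let DV (u : R -> R) : R -> R := (DW W V u) |W.

Lemma weak_identityE u g : HWVD W V u -> HWVD W V g ->
  (\int[dV V]_(x in circle) (kappa x ^+ 2 * u x * g x) +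
   \int[dW W]_(x in circle) (H x * DW W V u x * DW W V g x) =
     white_noise W V b g) <->
  (\int[nu]_x (k x * (u |V) x * (g |V) x) +
   \int[mu]_x (hH x * DV u x * DV g x) = - \int[mu]_x (beta x * DV g x)).
Proof.
move=> /HWVDP[su sDu _ _] /HWVDP[sg sDg _ _].
have -> : \int[dV V]_(x in circle) (kappa x ^+ 2 * u x * g x) =
    \int[nu]_x (k x * (u |V) x * (g |V) x).
  rewrite RintegralV; apply: eq_Rintegral => x _; rewrite /k !patchE.
  by case: ifP => // _; rewrite !mul0r.
have E1 : (fun x => H x * DW W V u x * DW W V g x) |W =
    (fun x => hH x * DV u x * DV g x).
  apply/funext => x; rewrite /hH /DV !patchE; case: ifP => // _.
  by rewrite !mul0r.
rewrite RintegralW; last first.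
  apply/measurable_circleP; rewrite E1; apply: measurable_funM; last by case: sDg.
  by apply: measurable_funM; [case: bmeas_hH|case: sDu].
rewrite E1.
have E2 : (fun s => lim (b @ s^'-) * DW W V g s) |W =
    (fun x => beta x * DV g x).
  apply/funext => x; rewrite /beta /DV !patchE; case: ifP => // _.
  by rewrite !mul0r.
rewrite /white_noise RintegralW ?E2//.
apply/measurable_circleP; rewrite E2; apply: measurable_funM.
  by case: sbeta.
by case: sDg.
Qed.

Lemma weak_solution_exists :
  exists u, weak_solution W V kappa H b u /\ cadlag_circle u.
Proof.
have ibeta := sqint_integrable sbeta.
have [c [u [bu uE F0]]] := shooting nu bmeas_h bmeas_k h_ge0 k_ge0 ibeta Rintegral_h_gt0.
pose F := slope nu h k beta c u.
have fl : @bmeas _ T R (flux nu k u) by apply: bmeas_flux => //; exact: bmeas_k.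
(* The slope is a bounded function minus [h * beta], and the latter inherits square integrability
   from [beta]. *)
have sF : sqint mu F.
  have -> : F = (fun y => h y * (c + flux nu k u y) - h y * beta y).
    by apply/funext => y; rewrite /F /slope; ring.
  apply: sqintB; last by apply: bmeasM_sqint => //; exact: bmeas_h.
  apply: bmeas_sqint; apply: bmeasM; first exact: bmeas_h.
  by apply: bmeasD => //; exact: bmeas_cst.
have FW : F |W = F.
  apply/funext => x; rewrite patchE; case: ifPn => // xW.
  by rewrite /F /slope /h patchE (negbTE xW) mul0r.
have su : sqint nu (u |V).
  apply: bmeas_sqint; apply: bmeas_restrict; first exact: measurable_circle.
    by apply: measurable_funTS; case: bu.
  have [_ [M uM]] := bu; exists M; split; first exact: num_real.
  by move=> x /ltW Mx y _; exact: le_trans (uM y) Mx.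
have [hu DuF] : HWVD W V u /\ ae_eq mu setT (DV u) (F |W).
  apply: HWVD_represents => //; rewrite ?FW//.
  by apply: aeW => x _; exact: uE.
exists u; split; last first.
  have iF := sqint_integrable sF; have uF : u = upto mu F by exact/funext.
  split => x _; rewrite uF; first exact: upto_right_continuous.
  exact: upto_left_limit.
split => // g hg; apply/weak_identityE => //.
have [sg sDg iDg gE] := HWVDP hg.
have iG := sqint_integrable sDg.
rewrite FW in DuF.
have bku : @bmeas _ T R (fun x => k x * u x) by exact: bmeasM bmeas_k bu.
(* By [weak_form] the dV-term is minus the integral of the flux against the derivative of [g]. In
   the dW-term [H] cancels [h] and the same integral appears with the opposite sign; [c] is killed
   by the zero mean, and [- beta] leaves the noise. *)
have -> : \int[nu]_x (k x * (u |V) x * (g |V) x) =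
    - \int[mu]_y (flux nu k u y * DV g y).
  transitivity (\int[nu]_x (k x * u x * upto mu (DV g) x)); last exact: weak_form.
  apply: ae_eq_Rintegral.
  - apply: measurable_funM; last by case: sg.
    by apply: measurable_funM; [case: bmeas_k|case: su].
  - by apply: measurable_funM; [case: bku|case: (bmeas_upto iG)].
  have FN : Filter (almost_everywhere nu) by exact: ae_filter_ringOfSetsType.
  apply: filterS gE => x gx _; rewrite /k !patchE; case: ifPn => [|_].
    by move=> /set_mem cx; rewrite -gx.
  by rewrite !mul0r.
have mDg : measurable_fun setT (DV g : T -> R) by case: sDg.
have mhH : measurable_fun setT (hH : T -> R) by case: bmeas_hH.
have -> : \int[mu]_x (hH x * DV u x * DV g x) =
    \int[mu]_x ((c - beta x + flux nu k u x) * DV g x).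
  transitivity (\int[mu]_x (hH x * F x * DV g x)).
    apply: ae_eq_Rintegral.
    - apply: measurable_funM => //; apply: measurable_funM => //.
      by have [_ [? _] _ _] := HWVDP hu.
    - by apply: measurable_funM => //; apply: measurable_funM => //; case: sF.
    by apply: filterS DuF => x /(_ I) + _; rewrite /DV => ->.
  apply: eq_Rintegral => x _; rewrite /F /slope /DV /hH /h !patchE.
  case: ifPn => [/set_mem /opencircle_circle cx|_]; last by rewrite !mulr0.
  by rewrite mulrA divff ?mul1r// gt_eqF// Hpos.
have ibg := sqintM sbeta sDg.
have ifg : mu.-integrable setT (EFin \o (fun y => flux nu k u y * DV g y)).
  exact: bmeasM_integrable.
have -> : \int[mu]_x ((c - beta x + flux nu k u x) * DV g x) =
    c * \int[mu]_y DV g y - \int[mu]_y (beta y * DV g y) +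
    \int[mu]_y (flux nu k u y * DV g y).
  have icG : mu.-integrable setT (EFin \o (fun y => c * DV g y)).
    by have := integrableZl measurableT c iG; apply: eq_integrable.
  rewrite -RintegralZl// -RintegralB// -RintegralD//; last first.
    have := integrable_lin (-1) icG ibg.
    by apply: eq_integrable => // x _ /=; rewrite mulN1r.
  by apply: eq_Rintegral => x _; ring.
by rewrite iDg mulr0 sub0r addrC addrK.
Qed.

Hypothesis kappa0 : bounded_away_from_zero kappa.

(* The difference w of two solutions is itself an admissible test function;
   tested against it, the two identities leave a sum of two nonnegative terms. *)
Lemma weak_solution_unique u v : weak_solution W V kappa H b u ->
  weak_solution W V kappa H b v -> v = u %[ae dV V in circle].
Proof.
move=> [hu wu] [hv wv].
have [su sDu iDu uE] := HWVDP hu; have [sv sDv iDv vE] := HWVDP hv.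
have FN : Filter (almost_everywhere nu) by exact: ae_filter_ringOfSetsType.
pose w x := v x - u x; pose G x := DW W V v x - DW W V u x.
have wV : w |V = (fun x => (v |V) x - (u |V) x).
  by apply/funext => x; rewrite /w !patchE; case: ifP => // _; rewrite subr0.
have GW : G |W = (fun x => DV v x - DV u x).
  by apply/funext => x; rewrite /G /DV !patchE; case: ifP => // _; rewrite subr0.
have iv := sqint_integrable sDv; have iu := sqint_integrable sDu.
have sw : sqint nu (w |V) by rewrite wV; exact: sqintB.
have sG : sqint mu (G |W) by rewrite GW; exact: sqintB.
have [hw DwG] : HWVD W V w /\ ae_eq mu setT (DV w) (G |W).
  apply: HWVD_represents => //.
    by rewrite GW RintegralB// iDv iDu subrr.
  apply: filterS2 uE vE => x ux vx cx; rewrite /w ux// vx// GW.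
  have -> : (fun x => DV v x - DV u x) = (fun x => DV v x + -1 * DV u x).
    by apply/funext => y; rewrite mulN1r.
  by rewrite upto_lin// mulN1r.
have [_ sDw _ _] := HWVDP hw.
have /(weak_identityE hv hw) Ev := wv w hw.
have /(weak_identityE hu hw) Eu := wu w hw.
have ikM f : sqint nu f -> nu.-integrable setT (EFin \o (fun x => k x * f x * (w |V) x)).
  by move=> sf; apply: sqintM => //; apply: bmeasM_sqint => //; exact: bmeas_k.
have ihM f : sqint mu f -> mu.-integrable setT (EFin \o (fun x => hH x * f x * DV w x)).
  by move=> sf; apply: sqintM => //; apply: bmeasM_sqint => //; exact: bmeas_hH.
pose A := \int[nu]_x (k x * (w |V) x * (w |V) x).
pose B := \int[mu]_x (hH x * (G |W) x * (G |W) x).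
have AE : A = \int[nu]_x (k x * (v |V) x * (w |V) x) - \int[nu]_x (k x * (u |V) x * (w |V) x).
  rewrite -RintegralB//; [|exact: ikM..].
  by apply: eq_Rintegral => x _; rewrite [in X in _ * X * _]wV; ring.
have BE : B = \int[mu]_x (hH x * DV v x * DV w x) - \int[mu]_x (hH x * DV u x * DV w x).
  rewrite -RintegralB//; [|exact: ihM..].
  (* [DV w] is the derivative chosen for [w]; it replaces one factor [G] almost everywhere. *)
  transitivity (\int[mu]_x (hH x * (G |W) x * DV w x)).
    have mhH : measurable_fun setT (hH : T -> R) by case: bmeas_hH.
    have mG : measurable_fun setT (G |W : T -> R) by case: sG.
    apply: ae_eq_Rintegral.
    - by apply: measurable_funM => //; apply: measurable_funM.
    - by apply: measurable_funM; [apply: measurable_funM|case: sDw].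
    by apply: filterS DwG => x /(_ I) + _ => ->.
  by apply: eq_Rintegral => x _; rewrite GW; ring.
have AB : A + B = 0 by rewrite AE BE addrACA -opprD Ev Eu subrr.
have A0 : 0 <= A.
  by apply: Rintegral_ge0 => x _; rewrite -mulrA mulr_ge0 ?k_ge0// -expr2 sqr_ge0.
have B0 : 0 <= B.
  by apply: Rintegral_ge0 => x _; rewrite -mulrA mulr_ge0 ?hH_ge0// -expr2 sqr_ge0.
(* The zeroth-order term identifies [u] and [v]: its integrand is nonnegative and [kappa] has no
   zero on the circle. *)
have {A0} A0 : A = 0 by apply/eqP; rewrite eq_le A0 andbT -AB lerDl.
have iA := ikM _ sw.
have : ae_eq nu setT (EFin \o (fun x => k x * (w |V) x * (w |V) x)) (cst 0%E).
  apply/ae_eq_integral_abs => //; first exact: (measurable_int _ iA).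
  under eq_integral => x _.
    rewrite gee0_abs; last first.
      by rewrite lee_fin -mulrA mulr_ge0 ?k_ge0// -expr2 sqr_ge0.
    over.
  by rewrite -(fineK (integrable_fin_num measurableT iA)) -[fine _]/A A0.
move=> w0; suff vu : {ae nu, forall x, circle x -> v x = u x}.
  exact: (@ae_mfrestr _ T R (dV V) circle (@measurable_circle R) (dV_circle_fin V)
    (fun x => v x = u x)).2 vu.
apply: filterS w0 => x /(_ I) [] + cx; rewrite /k !patchE mem_set//.
have [c c0 /(_ x cx) kc] := kappa0.
have kx : kappa x != 0 by rewrite -normr_gt0 (lt_le_trans c0).
move=> /eqP; rewrite mulf_eq0 mulf_eq0 sqrf_eq0 (negbTE kx)/= orbb subr_eq0.
by move/eqP.
Qed.

End well_posedness.

(** * Brownian paths *)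

Section left_limit_approximation.
Context (R : realType).
Local Notation T := (measurableTypeR R).
Implicit Types b : R -> R.

Definition node (n j : nat) : R := j%:R / n.+1%:R.

Definition cell (n j : nat) (s : R) : bool := (node n j < s) && (s <= node n j.+1).

(** Each cell is open on the left and the value is taken at its left endpoint, strictly before [s],
    so the limit is the left limit; all the nodes sampled are smaller than 1, where the process is
    specified. *)
Definition step b (n : nat) (s : R) : R :=
  \sum_(j < n.+1) b (node n j) * (cell n j s)%:R.

Lemma node_ge0 n j : 0 <= node n j.
Proof. by rewrite divr_ge0. Qed.

Lemma le_node n i j : (i <= j)%N -> node n i <= node n j.
Proof. by move=> ij; rewrite ler_pM2r ?invr_gt0 ?ltr0n// ler_nat. Qed.

Lemma node_last n : node n n.+1 = 1.
Proof. by rewrite /node divff// pnatr_eq0. Qed.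

Lemma cellP n s : 0 < s <= 1 -> exists2 j : 'I_n.+1, cell n j s &
  forall i : 'I_n.+1, i != j -> cell n i s = false.
Proof.
move=> /andP[s0 s1].
have ex : exists j, s <= node n j.+1 by exists n; rewrite node_last.
case: (ex_minnP ex) => j sj jmin.
have jn : (j < n.+1)%N by rewrite ltnS; apply: jmin; rewrite node_last.
have js : node n j < s.
  case: j sj jmin jn => [|j] sj jmin jn; first by rewrite /node mul0r.
  by rewrite ltNge; apply/negP => /jmin; rewrite ltnn.
exists (Ordinal jn); first by rewrite /cell js sj.
move=> i; rewrite -val_eqE/= neq_ltn /cell => /orP[ij|ij].
  by rewrite [s <= _]leNgt (le_lt_trans (le_node n ij) js) andbF.
by rewrite ltNge (le_trans sj (le_node n ij)).
Qed.

(* The same node t serves every function b. *)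
Lemma stepP n s : 0 < s <= 1 -> exists t, [/\ 0 <= t, t < s, s - t <= n.+1%:R^-1 &
  forall b, step b n s = b t].
Proof.
move=> /cellP -/(_ n)[j /andP[js sj] jN]; exists (node n j); split => //.
- exact: node_ge0.
- by rewrite lerBlDl (le_trans sj)// /node -natr1 mulrDl mul1r.
move=> b; rewrite /step (bigD1 j)//= {1}/cell js sj mulr1 big1 ?addr0// => i ij.
by rewrite jN// mulr0.
Qed.

Lemma step_cvg b s : 0 < s <= 1 -> cvg (b @ s^'-) ->
  step b n s @[n --> \oo] --> lim (b @ s^'-).
Proof.
move=> s01 cb; apply/cvgrPdist_le => e e0.
have /cvgrPdist_le/(_ e e0)[r /= r0 br] := cb.
near=> n; have [t [t0 ts sn ->]] := stepP n s01.
apply: br => //=; rewrite gtr0_norm ?subr_gt0// (le_lt_trans sn)//.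
by near: n; exact: near_infty_natSinv_lt (PosNum r0).
Unshelve. all: by end_near. Qed.

Lemma measurable_cell n j : measurable_fun setT (cell n j : T -> bool).
Proof. by apply: measurable_and; [exact: measurable_fun_ltr|exact: measurable_fun_ler]. Qed.

Lemma measurable_step b n : measurable_fun setT (step b n : T -> R).
Proof.
apply: measurable_sum => j; apply: measurable_funM => //.
by have [] := @bmeas_bool _ T R _ (measurable_cell n j).
Qed.

End left_limit_approximation.

(** * Second moment of a centred normal law *)

Section normal_moment.
Context (R : realType).
Local Notation leb := (@lebesgue_measure R).

(** The change of variables uses the Radon-Nikodym derivative of [normal_prob] with respect to
    Lebesgue measure; it agrees almost everywhere with the density since both have the same integral
    over every measurable set. *)
Lemma ge0_integral_normal_prob (s : R) (f : R -> \bar R) :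
  (forall x, 0 <= f x)%E -> measurable_fun setT f ->
  (\int[normal_prob 0 s]_x f x = \int[leb]_x (f x * (normal_pdf 0 s x)%:E))%E.
Proof.
move=> f0 mf; have dom := normal_prob_dominates 0 s.
rewrite -(Radon_Nikodym_SigmaFinite.change_of_variables dom f0 measurableT mf).
apply: ae_eq_integral => //.
- apply: emeasurable_funM => //; apply: (measurable_int leb).
  exact: Radon_Nikodym_SigmaFinite.f_integrable.
- by apply: emeasurable_funM => //; apply/measurable_EFinP; exact: measurable_normal_pdf.
apply: ae_eqe_mul2l; apply: integral_ae_eq => //.
- exact: Radon_Nikodym_SigmaFinite.f_integrable.
- by apply/measurable_EFinP; exact: measurable_normal_pdf.
- by move=> E _ mE; rewrite -Radon_Nikodym_SigmaFinite.f_integral.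
Qed.

(* y e^(-y) <= 1 with y = x^2 / (4 s^2) dominates x^2 times the density of
   N(0, s^2) by a multiple of the density of N(0, 2 s^2). *)
Lemma normal_second_moment (s : R) : s != 0 ->
  (\int[normal_prob 0 s]_x (x ^+ 2)%:E <= (Num.sqrt 2 * 4 * s ^+ 2)%:E)%E.
Proof.
move=> s0; rewrite ge0_integral_normal_prob//; last 2 first.
- by move=> x; rewrite lee_fin sqr_ge0.
- by apply/measurable_EFinP; exact: measurable_funX.
(* Half of the exponent, [- y], is that of the density with deviation [s']. In the constant,
   [4 * s ^+ 2] converts [y] back into [x ^+ 2] and [Num.sqrt 2] is the ratio of the two peaks. *)
pose s' := Num.sqrt 2 * s.
have s2 : s' ^+ 2 = 2 * s ^+ 2 by rewrite exprMn sqr_sqrtr.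
have s'0 : s' != 0 by rewrite mulf_neq0// gt_eqF// sqrtr_gt0.
have ss0 : 0 < s ^+ 2 by rewrite exprn_even_gt0.
have bnd x : x ^+ 2 * normal_pdf 0 s x <= Num.sqrt 2 * 4 * s ^+ 2 * normal_pdf 0 s' x.
  rewrite !normal_pdfE// /normal_fun !subr0 s2.
  have pk : normal_peak s = Num.sqrt 2 * normal_peak s'.
    have sq : Num.sqrt (2 * s ^+ 2 * pi *+ 2) = Num.sqrt 2 * Num.sqrt (s ^+ 2 * pi *+ 2).
      by rewrite -sqrtrM ?ler0n//; congr Num.sqrt; ring.
    by rewrite /normal_peak s2 sq invfM mulrA divff ?mul1r// gt_eqF// sqrtr_gt0.
  rewrite pk.
  set y := x ^+ 2 / (s ^+ 2 *+ 4).
  have y0 : 0 <= y by rewrite divr_ge0 ?sqr_ge0// mulrn_wge0// ltW.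
  have -> : - x ^+ 2 / (s ^+ 2 *+ 2) = - y - y.
    by rewrite /y; field.
  have -> : - x ^+ 2 / ((2 * s ^+ 2) *+ 2) = - y.
    by rewrite /y; field.
  have xy : x ^+ 2 = 4 * s ^+ 2 * y.
    by rewrite /y; field.
  rewrite xy expRD.
  have ye : y * expR (- y) <= 1.
    rewrite expRN ler_pdivrMr ?expR_gt0// mul1r.
    by apply: le_trans (expR_ge1Dx y); rewrite lerDr.
  have q0 : 0 <= Num.sqrt 2 * 4 * s ^+ 2 * (normal_peak s' * expR (- y)).
    apply: mulr_ge0; last by rewrite mulr_ge0 ?normal_peak_ge0 ?expR_ge0.
    by rewrite mulr_ge0 ?sqr_ge0// mulr_ge0 ?sqrtr_ge0.
  rewrite [leLHS](_ : _ = Num.sqrt 2 * 4 * s ^+ 2 * (normal_peak s' * expR (- y)) *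
    (y * expR (- y))); last by ring.
  by rewrite -[leRHS]mulr1 ler_wpM2l.
apply: (@le_trans _ _ (\int[leb]_x (Num.sqrt 2 * 4 * s ^+ 2 * normal_pdf 0 s' x)%:E)%E).
  apply: ge0_le_integral => //.
  - by move=> x _; rewrite -EFinM lee_fin mulr_ge0 ?sqr_ge0 ?normal_pdf_ge0.
  - apply/measurable_EFinP; apply: measurable_funM; first exact: measurable_funX.
    exact: measurable_normal_pdf.
  - by apply/measurable_EFinP; apply: measurable_funM => //; exact: measurable_normal_pdf.
  - by move=> x _; rewrite -EFinM lee_fin.
under eq_integral do rewrite EFinM.
rewrite integralZl//; last exact: integrable_normal_pdf.
by rewrite integral_normal_pdf mule1.
Qed.

End normal_moment.

(** * Square integrability of the left limits *)

Section brownian_paths.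
Context (R : realType) (W : cadlag_driver R).
Context d (Omega : measurableType d) (P : probability Omega R).
Local Notation T := (measurableTypeR R).
Variable B : R -> {RV P >-> R}.
Hypothesis bm : is_W_brownian_motion W B.

Lemma le_W (x y : R) : x <= y -> W x <= W y.
Proof. by apply: (@ltW_homo _ _ R R); exact: W_increasing. Qed.

Lemma brownian_second_moment (t : R) : 0 <= t < 1 ->
  (\int[P]_w ((B t w) ^+ 2)%:E <= (Num.sqrt 2 * 4 * W 1)%:E)%E.
Proof.
have FP : Filter (almost_everywhere P) by exact: ae_filter_ringOfSetsType.
have mB2 s : measurable_fun setT (fun w => ((B s w) ^+ 2)%:E).
  by apply/measurable_EFinP; exact: measurable_funX.
have W1 : 0 <= W 1 by rewrite -(W0 W) le_W.
(* The law of an increment is given for [s < t] only, so [t = 0] is treated through the almost sure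
   vanishing of [B 0]. *)
move=> /andP[]; rewrite le_eqVlt => /predU1P[<- _|t0 t1].
  rewrite (@ge0_ae_eq_integral _ _ _ P setT _ (cst 0%E))//.
  - by rewrite integral0 lee_fin mulr_ge0// mulr_ge0// sqrtr_ge0.
  - by move=> w _; rewrite lee_fin sqr_ge0.
  - by apply: filterS (brownian0 bm) => w Bw _; rewrite Bw expr0n.
pose X := increment B 0 t.
have mX : measurable_fun setT X by exact: measurable_funB.
have mXT : @measurable_fun _ _ Omega T setT X by exact: mX.
rewrite (@ge0_ae_eq_integral _ _ _ P setT _ (fun w => (X w ^+ 2)%:E))//; last 4 first.
- by apply/measurable_EFinP; exact: measurable_funX.
- by move=> w _; rewrite lee_fin sqr_ge0.
- by move=> w _; rewrite lee_fin sqr_ge0.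
- by apply: filterS (brownian0 bm) => w Bw _; rewrite /X /increment Bw subr0.
have sigma2 : 0 < W t - W 0 by rewrite subr_gt0 W_increasing.
have -> : (\int[P]_w (X w ^+ 2)%:E =
    \int[normal_prob 0%R (Num.sqrt (W t - W 0)%R)]_x (x ^+ 2)%:E)%E.
  pose Xm : {mfun Omega >-> T} :=
    HB.pack (X : Omega -> T) (@isMeasurableFun.Build _ _ Omega T X mXT).
  transitivity (\int[pushforward P Xm]_x (x ^+ 2)%:E)%E.
    rewrite (ge0_integral_pushforward mXT)//.
    - by apply/measurable_EFinP; exact: measurable_funX.
    - by move=> x _; rewrite lee_fin sqr_ge0.
  apply: eq_measure_integral => A mA _.
  exact: (brownian_normal bm).
apply: le_trans (normal_second_moment _) _; first by rewrite gt_eqF// sqrtr_gt0.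
rewrite sqr_sqrtr; last exact: ltW.
rewrite lee_fin ler_wpM2l ?mulr_ge0 ?sqrtr_ge0//.
by rewrite W0 subr0; apply: le_W; exact: ltW.
Qed.

Let path (w : Omega) (t : R) : R := B t w.

Let energy (n : nat) (w : Omega) : \bar R :=
  (\int[muW W]_(s in opencircle) ((step (path w) n s) ^+ 2)%:E)%E.

Let weight (n j : nat) : R := fine (muW W ([set s | cell n j s] `&` opencircle)).

Let mcell n j : measurable ([set s | cell n j s] : set T).
Proof.
have -> : [set s | cell n j s] = (`]node R n j, node R n j.+1]%classic : set T).
  by apply/seteqP; split => s /=; rewrite in_itv.
exact: measurable_itv.
Qed.

Let weight_ge0 n j : 0 <= weight n j.
Proof. by apply: fine_ge0. Qed.

Let le_weight n j : weight n j <= W (node R n j.+1) - W (node R n j).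
Proof.
have nn : node R n j <= node R n j.+1 by exact: le_node.
rewrite -lee_fin /weight fineK; last first.
  by apply: fin_num_measure; apply: measurableI => //; exact: measurable_opencircle.
rewrite -dW_itv//= /mfrestr /mrestr.
apply: le_measure; rewrite ?inE; [|exact: measurable_itv|].
  apply: measurableI; last exact: measurable_opencircle.
  by apply: measurableI => //; exact: measurable_opencircle.
by move=> s [[/= + _] _]; rewrite in_itv.
Qed.

(** As a finite sum over the nodes, the energy is visibly measurable in [w], and its expectation
    involves only second moments at single times; no joint measurability in [s] and [w] has to be
    established. *)
Let energyE n w :
  energy n w = (\sum_(j < n.+1) ((path w (node R n j)) ^+ 2 * weight n j)%:E)%E.
Proof.
rewrite /energy; transitivity (\int[muW W]_(s in opencircle)
    \sum_(j < n.+1) ((path w (node R n j)) ^+ 2)%:E * (\1_[set s | cell n j s] s)%:E)%E.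
  apply: eq_integral => s; rewrite inE /opencircle/= in_itv/= => /andP[s0 s1].
  have [t [_ _ _ st]] : exists t : R, [/\ 0 <= t, t < s, s - t <= n.+1%:R^-1 &
      forall b, step b n s = b t] by apply: stepP; rewrite s0 ltW.
  (* One node serves the path and its square, so squaring commutes with [step]. *)
  rewrite st -(st (fun t => (path w t) ^+ 2)) /step -sumEFin.
  by apply: eq_bigr => j _; rewrite EFinM indicE mem_setE.
rewrite ge0_integral_sum//; first last.
- by move=> j s _; rewrite mule_ge0// lee_fin sqr_ge0.
- move=> j; apply: emeasurable_funM => //.
  by apply/measurable_EFinP; apply: measurable_indic; exact: mcell.
- exact: measurable_opencircle.
apply: eq_bigr => j _.
rewrite ge0_integralZl//; last 3 first.
- exact: measurable_opencircle.
- by apply/measurable_EFinP; apply: measurable_indic; exact: mcell.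
- by rewrite lee_fin sqr_ge0.
rewrite integral_indic//; last exact: measurable_opencircle.
rewrite [RHS]EFinM /weight fineK//.
by apply: fin_num_measure; apply: measurableI => //; exact: measurable_opencircle.
Qed.

Let measurable_energy n : measurable_fun setT (energy n).
Proof.
rewrite (funext (energyE n)); under eq_fun do rewrite sumEFin.
apply/measurable_EFinP; apply: measurable_sum => j.
by apply: measurable_funM => //; exact: measurable_funX.
Qed.

(** The second moments share one bound, and the weights are at most the increments of [W] over the
    cells, which telescope to [W 1]; hence uniformity in [n]. *)
Let energy_bound n : (\int[P]_w energy n w <= (Num.sqrt 2 * 4 * W 1 * W 1)%:E)%E.
Proof.
under eq_integral do rewrite energyE.
rewrite ge0_integral_sum//; first last.
- by move=> j w _; rewrite lee_fin mulr_ge0// sqr_ge0.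
- move=> j; apply/measurable_EFinP; apply: measurable_funM => //.
  exact: measurable_funX.
have W1 : 0 <= W 1 by rewrite -(W0 W) le_W.
apply: (@le_trans _ _ (\sum_(j < n.+1) (Num.sqrt 2 * 4 * W 1 *
    (W (node R n j.+1) - W (node R n j)))%:E)%E).
  apply: lee_sum => j _; under eq_integral do rewrite EFinM muleC.
  rewrite ge0_integralZl//; last 3 first.
  - by apply/measurable_EFinP; exact: measurable_funX.
  - by move=> w _; rewrite lee_fin sqr_ge0.
  - by rewrite lee_fin.
  rewrite muleC EFinM lee_pmul ?lee_fin ?weight_ge0 ?le_weight//.
  - by apply: integral_ge0 => w _; rewrite lee_fin sqr_ge0.
  - apply: brownian_second_moment; rewrite node_ge0/=.
    by rewrite ltr_pdivrMr ?ltr0n// mul1r ltr_nat.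
rewrite sumEFin lee_fin -mulr_sumr -(big_mkord xpredT
  (fun j => W (node R n j.+1) - W (node R n j))) telescope_sumr//.
by rewrite node_last /node mul0r W0 subr0.
Qed.

(* Fatou's lemma, once in the probability space and once in the time variable,
   bounds the L^2 norm of the path of left limits by those of its step
   approximations. *)
Lemma brownian_left_limits_sqint : {ae P, forall w,
  sqint (muW W) ((fun s => lim ((fun t => B t w) @ s^'-)) \_ opencircle)}.
Proof.
have FP : Filter (almost_everywhere P) by exact: ae_filter_ringOfSetsType.
have e0 n w : (0 <= energy n w)%E.
  by apply: integral_ge0 => s _; rewrite lee_fin sqr_ge0.
have ml : measurable_fun setT (fun w => limn_einf (energy ^~ w)).
  apply: (emeasurable_fun_cvg (fun n w => einfs (energy ^~ w) n)) => [n|w _].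
    exact: measurable_fun_einfs.
  by rewrite limn_einf_lim; exact: is_cvg_einfs.
have l0 w : (0 <= limn_einf (energy ^~ w))%E.
  rewrite limn_einf_lim; apply: lime_ge; first exact: is_cvg_einfs.
  by apply: nearW => n; apply: le_ereal_inf_tmp => _ [m _ <-].
have lK (u : nat -> \bar R) (K : \bar R) : (forall n, u n <= K)%E -> (limn_einf u <= K)%E.
  move=> uK; rewrite limn_einf_lim; apply: lime_le; first exact: is_cvg_einfs.
  apply: nearW => n; apply: le_trans (uK n); apply: ereal_inf_lbound.
  by exists n => /=.
have il : P.-integrable setT (fun w => limn_einf (energy ^~ w)).
  apply/integrableP; split => //.
  under eq_integral do rewrite gee0_abs//.
  apply: le_lt_trans (fatou P measurableT _ _) _ => //.
  by apply: le_lt_trans (lK _ _ energy_bound) _; rewrite ltry.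
(* From here on the path is fixed, and the lower limit of its energies is finite. *)
apply: filterS (integrable_ae measurableT il) => w /(_ I) lfin.
pose b t := B t w; pose beta := (fun s => lim (b @ s^'-)) \_ opencircle.
pose f n := step b n \_ opencircle.
have cf s : f n s @[n --> \oo] --> beta s.
  rewrite /f /beta; under eq_fun do rewrite patchE; rewrite patchE.
  case: ifPn => [|_]; last exact: cvg_cst.
  rewrite inE /opencircle/= in_itv/= => /andP[s0 s1].
  apply: step_cvg; first by rewrite s0 ltW.
  have [_ bl] := brownian_cadlag bm w.
  by apply: bl; rewrite /= in_itv/= s0.
have mf n : measurable_fun setT (f n : T -> R).
  apply: (@measurable_restrictT _ _ T R opencircle (step b n) (@measurable_opencircle R)).1.
  by apply: measurable_funTS; exact: measurable_step.
have mbeta : measurable_fun setT (beta : T -> R) by exact: measurable_fun_pointwise_cvg cf.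
split => //; apply/integrableP; split.
  by apply/measurable_EFinP; exact: measurable_funX.
rewrite (_ : (\int[_]_x _ = \int[muW W]_s limn_einf (fun n => ((f n s) ^+ 2)%:E))%E); last first.
  apply: eq_integral => s _; rewrite /= ger0_norm ?sqr_ge0//.
  have c2 : ((f n s) ^+ 2)%:E @[n --> \oo] --> ((beta s) ^+ 2)%:E.
    apply: cvg_EFin; first exact: nearW.
    rewrite expr2; under eq_fun do rewrite /= expr2.
    exact: cvgM.
  by have [-> _] := cvg_limn_einf_sup c2.
apply: le_lt_trans (fatou _ measurableT _ _) _.
- by move=> n; apply/measurable_EFinP; exact: measurable_funX.
- by move=> n s _; rewrite lee_fin sqr_ge0.
rewrite (_ : (fun n => _) = energy ^~ w) ?ltey_eq ?lfin//.
apply/funext => n; rewrite /energy [RHS]integral_mkcond; apply: eq_integral => s _.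
by rewrite /f !patchE; case: ifP => // _; rewrite expr0n.
Qed.

End brownian_paths.

Theorem theorem1p7p3 (R : realType) (W : cadlag_driver R) (V : caglad_driver R)
    (kappa H : R -> R)
    (d : measure_display) (Omega : measurableType d) (P : probability Omega R)
    (B : R -> {RV P >-> R}) :
  measurable_fun circle kappa -> measurable_fun circle H ->
  [bounded kappa x | x in circle] -> [bounded H x | x in circle] ->
  bounded_away_from_zero kappa -> bounded_away_from_zero H ->
  (forall x, circle x -> 0 < H x) ->
  is_W_brownian_motion W B ->
  {ae P, forall omega : Omega, exists u : R -> R,
    [/\ weak_solution W V kappa H (fun t => B t omega) u,
        cadlag_circle u &
        forall v : R -> R, weak_solution W V kappa H (fun t => B t omega) v ->
          v = u %[ae dV V in circle] ] }.
Proof.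
move=> mkappa mH bkappa bH kappa0 H0 Hpos bm.
have FP : Filter (almost_everywhere P) by exact: ae_filter_ringOfSetsType.
apply: filterS (brownian_left_limits_sqint bm) => omega sbeta.
have [u [wu cu]] := weak_solution_exists V mkappa mH bkappa bH H0 Hpos sbeta.
exists u; split => // v wv.
exact: (weak_solution_unique mkappa mH bkappa bH Hpos sbeta kappa0 wu wv).
Qed.
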